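(* Let $G<\widehat{\mathrm{Diff}}(\mathbb C^n,0)$ be a subgroup containing a regular dicritic diffeomorphism $\hat f\in G$ and containing its derivative subgroup, $DG<G$. The following conditions are equivalent: (1) $G$ is abelian; (2) $DG$ is abelian and $\hat X=\log\hat f$ is invariant by $G$.
   Context: $\widehat{\mathrm{Diff}}(\mathbb C^n,0)$ is the group (under composition) of formal diffeomorphisms of $\mathbb C^n$ fixing the origin. $DG=\{\hat g'(0):\hat g\in G\}<GL(n,\mathbb C)$ is the derivative subgroup; its elements are regarded as linear diffeomorphisms. $\hat X$ is $G$-invariant if $\hat g_*\hat X=\hat X$ for all $\hat g\in G$. For $k\ge1$, $\widehat{\mathrm{Diff}}_k(\mathbb C^n,0)$ is the set of $\hat f(z)=z+f_{k+1}(z)+f_{k+2}(z)+\cdots$ with $f_j$ homogeneous of degree $j$ and $f_{k+1}\ne0$; $\hat{\mathcal X}_k(\mathbb C^n,0)$ is the set of formal vector fields whose coefficients have minimum vanishing order $k+1$ at $0$. The exponential $\exp(\hat X)=\big(\sum_j\frac1{j!}\hat X^j(z_i)\big)_{i}$ is a bijection $\hat{\mathcal X}_k\to\widehat{\mathrm{Diff}}_k$; the infinitesimal generator $\log\hat f$ of $\hat f\in\widehat{\mathrm{Diff}}_k$ is its preimage. $\hat X\in\hat{\mathcal X}_k(\mathbb C^n,0)$ is dicritic if $\hat X=f(z)\vec R+\sum_{i=1}^n(p^{(i)}_{k+2}+\cdots)\frac{\partial}{\partial z_i}$, with $f$ a homogeneous polynomial of degree $k$, $\vec R=\sum z_i\frac{\partial}{\partial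 z_i}$, $p^{(i)}_{k+2}$ homogeneous of degree $k+2$ and dots denoting higher order terms. It is regular dicritic if moreover there are $i_0,j_0$ such that $f$ and $z_{j_0}p^{(i_0)}_{k+2}-z_{i_0}p^{(j_0)}_{k+2}$ are coprime. $\hat f\in\widehat{\mathrm{Diff}}_k$ is regular dicritic if $\log\hat f$ is regular dicritic. *)

(* Defs.v *)
From HB Require Import structures.
From mathcomp Require Import all_boot all_order all_algebra.
From mathcomp Require Import reals complex mpoly.
From Stdlib Require Import ClassicalEpsilon.

Set Implicit Arguments.
Unset Strict Implicit.
Unset Printing Implicit Defensive.

Import GRing.Theory.
Local Open Scope ring_scope.

Section FormalSeries.
Variables (K : fieldType) (n : nat).

(* K[[z_1, ..., z_n]]: a series is the family of its coefficients. *)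
Definition fps := 'X_{1..n} -> K.

Implicit Types (f g : fps) (p q d : {mpoly K[n]}) (i j : 'I_n).

Definition fps_of_mpoly p : fps := fun m => p@_m.

Definition fps_mul f g : fps := fun m =>
  \sum_(k : 'X_{1..n < (mdeg m).+1, (mdeg m).+1} | m == (k.1 + k.2)%MM)
     f k.1 * g k.2.

Definition fps_diff i f : fps := fun m => f (m + U_(i))%MM *+ (m i).+1.

Definition fps_trunc e f : {mpoly K[n]} :=
  \sum_(m : 'X_{1..n < e.+1}) f m *: 'X_[m].

Definition fps_hpart e f : {mpoly K[n]} :=
  \sum_(m : 'X_{1..n < e.+1} | mdeg m == e) f m *: 'X_[m].

(* The substitution f(F_1, ..., F_n); meaningful when no F_i has a constant
   term, in which case the coefficients of degree <= e of the result only
   depend on the e-jets of f and of the F_i. *)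
Definition fps_comp f (F : 'I_n -> fps) : fps := fun m =>
  (fps_trunc (mdeg m) f \mPo [tuple fps_trunc (mdeg m) (F i) | i < n])@_m.

Definition fmap := 'I_n -> fps.

Definition fmap_id : fmap := fun i => fps_of_mpoly 'X_i.

Definition fmap_comp (F H : fmap) : fmap := fun i => fps_comp (F i) H.

Definition fmap_lin (A : 'M[K]_n) : fmap :=
  fun i => fps_of_mpoly (\sum_j A i j *: 'X_j).

Definition jac0 (F : fmap) : 'M[K]_n := \matrix_(i, j) F i U_(j)%MM.

Definition is_fdiffeo (F : fmap) : Prop :=
  (forall i, F i 0%MM = 0) /\ jac0 F \in unitmx.

Definition is_inverse (F H : fmap) : Prop :=
  [/\ is_fdiffeo H, fmap_comp F H = fmap_id & fmap_comp H F = fmap_id].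

Definition fmap_inv (F : fmap) : fmap :=
  epsilon (inhabits fmap_id) (is_inverse F).

Record is_fdiffeo_subgroup (G : fmap -> Prop) : Prop := FdiffeoSubgroup {
  subgroup_fdiffeo : forall F, G F -> is_fdiffeo F;
  subgroup_id : G fmap_id;
  subgroup_comp : forall F H, G F -> G H -> G (fmap_comp F H);
  subgroup_inv : forall F, G F -> exists2 H, G H & is_inverse F H
}.

Definition abelian_fdiffeo (G : fmap -> Prop) : Prop :=
  forall F H, G F -> G H -> fmap_comp F H = fmap_comp H F.

Definition derivative_group (G : fmap -> Prop) : 'M[K]_n -> Prop :=
  fun A => exists2 F, G F & A = jac0 F.

Definition abelian_mx (D : 'M[K]_n -> Prop) : Prop :=
  forall A B, D A -> D B -> A *m B = B *m A.

(* Diff_k, meant for k >= 1 *)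
Definition is_tangent_id (k : nat) (F : fmap) : Prop :=
  (forall i m, (mdeg m <= k)%N -> F i m = fmap_id i m) /\
  (exists i, fps_hpart k.+1 (F i) != 0).

(* X stands for \sum_i X_i d/dz_i. *)
Definition fvect := 'I_n -> fps.

Implicit Type X : fvect.

Definition vanishes_to (k : nat) X : Prop :=
  (forall i m, (mdeg m <= k)%N -> X i m = 0) /\
  (exists i, fps_hpart k.+1 (X i) != 0).

Definition fvect_app X f : fps := fun m =>
  \sum_i fps_mul (X i) (fps_diff i f) m.

(* (F_* X)_i = X(F_i) o F^-1 *)
Definition pushforward (F : fmap) X : fvect :=
  fun i => fps_comp (fvect_app X (F i)) (fmap_inv F).

Definition invariant_by (G : fmap -> Prop) X : Prop :=
  forall F, G F -> pushforward F X = X.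

(* When X has order >= 2, X^j(z_i) has order > j, so that the terms of the
   exponential series with j > deg m do not contribute to the coefficient
   of z^m: see [fvect_exp_term_eq0]. *)
Definition fvect_exp X : fmap := fun i m =>
  \sum_(j < (mdeg m).+1) iter j (fvect_app X) (fmap_id i) m / j`!%:R.

Lemma fvect_exp_term_eq0 X i (j : nat) m :
  (forall l a, (mdeg a <= 1)%N -> X l a = 0) -> (mdeg m <= j)%N ->
  iter j (fvect_app X) (fmap_id i) m = 0.
Proof.
move=> X0; elim: j m => [|j IHj] m lemj /=.
  rewrite /fmap_id /fps_of_mpoly mcoeffX.
  case: eqP => // m1; move: lemj; by rewrite -m1 mdeg1.
rewrite /fvect_app big1 // => l _; rewrite /fps_mul big1 // => k /eqP mE.
have [lek1|gtk1] := leqP (mdeg k.1) 1; first by rewrite X0 ?mul0r.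
rewrite /fps_diff IHj ?mul0rn ?mulr0 // mdegD mdeg1.
have dE := congr1 mdeg mE; rewrite mdegD in dE.
rewrite addn1 -ltnS; apply: leq_trans lemj.
apply: (@leq_trans (mdeg k.1 + mdeg k.2)); last by rewrite -dE.
by rewrite -add2n leq_add2r.
Qed.

(* The infinitesimal generator: the preimage of F under the bijection exp from
   the union over k >= 1 of the sets [vanishes_to k] to that of the sets
   [is_tangent_id k]. *)
Definition fmap_log (F : fmap) : fvect :=
  epsilon (inhabits ((fun _ _ => 0) : fvect))
    (fun X => (exists2 k, (1 <= k)%N & vanishes_to k X) /\ fvect_exp X = F).

Definition mpoly_dvd d p : Prop := exists q, p = q * d.

Definition mpoly_coprime p q : Prop :=
  forall d, mpoly_dvd d p -> mpoly_dvd d q -> d \is a GRing.unit.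

(* X is dicritic with X = f R + (terms of order >= k + 2), where R is the
   radial vector field \sum_i z_i d/dz_i. *)
Definition dicritic_with (k : nat) X (f : {mpoly K[n]}) : Prop :=
  [/\ vanishes_to k X, f \is k.-homog
    & forall i, fps_hpart k.+1 (X i) = f * 'X_i].

Definition regular_dicritic (k : nat) X : Prop :=
  exists2 f, dicritic_with k X f & exists i0 j0, mpoly_coprime f
    ('X_j0 * fps_hpart k.+2 (X i0) - 'X_i0 * fps_hpart k.+2 (X j0)).

Definition regular_dicritic_fdiffeo (F : fmap) : Prop :=
  exists k, [/\ (1 <= k)%N, is_tangent_id k F & regular_dicritic k (fmap_log F)].

End FormalSeries.

(* Main.v *)
Require Import Defs.
From HB Require Import structures.
From mathcomp Require Import all_boot all_order all_algebra.
From mathcomp Require Import reals complex mpoly.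
From mathcomp Require Import ring zify boolp.
From Stdlib Require Import ClassicalEpsilon.

(* Both directions are read off from the operators f |-> f o H and e^X on
   formal series.  An order-preserving operator commuting with e^X commutes
   with X, because its commutator with X raises orders arbitrarily; so H
   commutes with F = e^X if and only if X is H-invariant.  Conversely, every
   H in G is A o P with A in DG and P tangent to the identity, P = e^Y with
   [X, Y] = 0.  Comparing the two lowest homogeneous parts of X Y = Y X gives
   Y = g R + ..., g of degree k, and f (z_j q_i - z_i q_j) = g (z_j p_i - z_i p_j),
   where p and q are the parts of degree k + 2 of X and Y.  Coprimality and
   unique factorization make g = c f, and then Y = c X: otherwise Y - c X would
   be a vector field commuting with X of order other than k + 1.  Hence the
   elements of G are the A o e^(cX), and these commute. *)

Set Implicit Arguments.
Unset Strict Implicit.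
Unset Printing Implicit Defensive.

Import GRing.Theory.
Local Open Scope ring_scope.

(** * Factorial rings *)

(** A map H is handled only through its pullback f |-> f o H: composition of maps becomes
    composition of operators in reverse order, invariance of X becomes commutation with the
    pullback, and either can be checked modulo any order. The assumption DG < G serves twice. With A
    = H'(0), it places P = A^-1 o H in G, so that X is invariant by P and therefore commutes with
    the logarithm Y of P; and it makes X invariant by A itself, so that A commutes with every
    e^(cX). Unique factorization in K[z_1, ..., z_n] comes from Gauss's lemma, one variable at a
    time. *)

Section Factorial.
Variable R : idomainType.
Implicit Types (a b c d p : R) (s : seq R).

Definition divides a b := exists q, b = q * a.

Definition prime_elt p :=
  [/\ p != 0, p \isn't a GRing.unit
    & forall a b, divides p (a * b) -> divides p a \/ divides p b].

(** The factors are primes rather than irreducibles, so that uniqueness is built in; the count [l]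
    is exposed because the arguments below are inductions on it. *)
Definition prime_factors (l : nat) a :=
  exists u s, [/\ u \is a GRing.unit, forall p, p \in s -> prime_elt p,
                  size s = l & a = u * \prod_(p <- s) p].

Definition factorial_ring := forall a, a != 0 -> exists l, prime_factors l a.

Lemma divides_unit a b : divides a b -> b \is a GRing.unit ->
  a \is a GRing.unit.
Proof. by case=> q ->; rewrite unitrM => /andP[]. Qed.

Lemma prime_dividesM p a : prime_elt p -> divides p (p * a).
Proof. by exists a; rewrite mulrC. Qed.

Lemma prime_factorsM p l a : prime_elt p -> prime_factors l a ->
  prime_factors l.+1 (p * a).
Proof.
move=> pp [u [s [uu ps sz ->]]]; exists u, (p :: s); split => //=.
- by move=> q; rewrite inE => /orP[/eqP->|/ps].
- by rewrite sz.
by rewrite big_cons mulrCA.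
Qed.

Lemma prime_factorsS l a : prime_factors l.+1 a ->
  exists p b, [/\ prime_elt p, prime_factors l b & a = p * b].
Proof.
case=> u [[|p s] [uu ps //= [sz] ->]].
exists p, (u * \prod_(q <- s) q); split.
- by apply: ps; rewrite mem_head.
- by exists u, s; split => // q qs; apply: ps; rewrite inE qs orbT.
by rewrite big_cons mulrCA.
Qed.

Lemma prime_factors0 a : prime_factors 0 a -> a \is a GRing.unit.
Proof. by case=> u [s [uu _ /size0nil-> ->]]; rewrite big_nil mulr1. Qed.

Lemma prime_factorsZ u l a : u \is a GRing.unit -> prime_factors l a ->
  prime_factors l (u * a).
Proof.
move=> uu [v [s [vu ps sz ->]]]; exists (u * v), s.
by rewrite unitrM uu vu mulrA.
Qed.

(** Take a listed prime q of p * a. If q divides p, the two are associates and cancel up to a unit;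
    otherwise q divides a, and the induction applies to the quotient. *)
Lemma prime_factors_div p l a : prime_elt p -> prime_factors l (p * a) ->
  exists2 l', l = l'.+1 & prime_factors l' a.
Proof.
move=> pp; have [p0 pu pdiv] := pp.
elim: l a => [|l IHl] a.
  move=> /prime_factors0; rewrite unitrM => /andP[pu']; by rewrite pu' in pu.
case/prime_factorsS => q [b [qp lb e]]; have [q0 qu qdiv] := qp.
exists l => //.
have [] : divides q p \/ divides q a.
  by apply: qdiv; rewrite e; apply: prime_dividesM.
- case=> t pE; have : divides p (t * q) by exists 1; rewrite mul1r pE.
  case/pdiv => [[r tE]|[r qE]].
    have : p * (r * q) = p * 1 by rewrite mulr1 mulrCA mulrA -tE -pE.
    move/(mulfI p0) => rq1; case/negP: qu.
    by apply/unitrPr; exists r; rewrite mulrC.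
  have tu : t \is a GRing.unit.
    apply/unitrPr; exists r; apply: (mulIf p0).
    by rewrite mul1r -mulrA -qE -pE.
  have -> : a = t^-1 * b.
    have -> : b = t * a by apply: (mulfI q0); rewrite -e {1}pE mulrAC mulrC.
    by rewrite mulKr.
  by apply: prime_factorsZ => //; rewrite unitrV.
case=> t aE; have bE : b = p * t.
  by apply: (mulfI q0); rewrite -e aE mulrA mulrC.
rewrite bE in lb; have [l' lE lt] := IHl _ lb.
by rewrite lE aE mulrC; apply: prime_factorsM.
Qed.

(** Induction on the number of primes of a: such a prime p divides c * b but not b, by coprimality,
    so it divides c and cancels on both sides. *)
Lemma factorial_coprime_divides a b c : factorial_ring ->
  (forall d, divides d a -> divides d b -> d \is a GRing.unit) ->
  divides a (c * b) -> divides a c.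
Proof.
move=> factR; have [->|a0] := eqVneq a 0.
  move=> cop [q]; rewrite mulr0 => /eqP; rewrite mulf_eq0 => /orP[/eqP->|b0].
    by move=> *; exists 0; rewrite mulr0.
  have : b \is a GRing.unit.
    by apply: cop; [exists 0; rewrite mul0r | exists 1; rewrite mul1r].
  by rewrite (eqP b0) unitr0.
have [l] := factR a a0; elim: l a c {a0} => [|l IHl] a c.
  by move=> /prime_factors0 au _ _; exists (c / a); rewrite divrK.
case/prime_factorsS => p [a' [pp la ->]] cop [q e].
have [p0 pu pdiv] := pp.
have [] : divides p c \/ divides p b.
  by apply: pdiv; exists (q * a'); rewrite e mulrCA mulrC.
- case=> c' cE; have [] // := IHl a' c' la.
  + by move=> d [r rE]; apply: cop; exists (p * r); rewrite rE mulrA.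
  + by exists q; apply: (mulfI p0); rewrite mulrA [p * c']mulrC -cE e mulrCA.
  by move=> r c'E; exists r; rewrite cE c'E -mulrA [a' * p]mulrC.
move=> pb; case/negP: pu; apply: cop => //; exact: prime_dividesM.
Qed.

End Factorial.

Lemma factorial_ring_iso (R S : idomainType) (phi : {rmorphism S -> R}) :
  injective phi -> (forall y, exists x, phi x = y) ->
  factorial_ring R -> factorial_ring S.
Proof.
move=> phi_inj phi_surj factR.
have unit_phi x : (phi x \is a GRing.unit) = (x \is a GRing.unit).
  apply/idP/idP; last exact: rmorph_unit.
  case/unitrPr => y; have [x' <-] := phi_surj y.
  rewrite -rmorphM -[1](rmorph1 phi) => /phi_inj e.
  by apply/unitrPr; exists x'.
have prime_phi x : prime_elt (phi x) -> prime_elt x.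
  case=> x0 xu xdiv; split; last 1 first.
  - move=> a b [q e]; case: (xdiv (phi a) (phi b)).
    + by exists (phi q); rewrite -!rmorphM e.
    + case=> q'; have [r <-] := phi_surj q'.
      by rewrite -rmorphM => /phi_inj ->; left; exists r.
    case=> q'; have [r <-] := phi_surj q'.
    by rewrite -rmorphM => /phi_inj ->; right; exists r.
  - by apply: contraNneq x0 => ->; rewrite rmorph0.
  by rewrite -unit_phi.
move=> a a0; have [|l la] := factR (phi a).
  by rewrite -(rmorph0 phi) (inj_eq phi_inj).
exists l; elim: l a {a0} la => [|l IHl] a.
  move=> /prime_factors0; rewrite unit_phi => au.
  by exists a, [::]; rewrite big_nil mulr1.
case/prime_factorsS => p [b [pp lb e]].
have [[p' pE] [b' bE]] := (phi_surj p, phi_surj b).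
have -> : a = p' * b' by apply: phi_inj; rewrite rmorphM e pE bE.
by apply: prime_factorsM; [apply: prime_phi; rewrite pE | apply: IHl; rewrite bE].
Qed.

(** * Gauss's lemma: polynomials over a factorial ring *)

Section PolyFactorial.
Variable R : idomainType.
Hypothesis factR : factorial_ring R.
Implicit Types (a b c p : R) (f g h : {poly R}).

(** Induction on the total size of f and g: p divides the leading coefficient of f * g, hence that
    of f or of g, and this leading term can be removed without affecting divisibility by p. *)
Lemma prime_polyC p : prime_elt p -> prime_elt p%:P.
Proof.
case=> p0 pu pdiv; split; first by rewrite polyC_eq0.
  apply: contra pu => /unitrPr[q /(congr1 (coefp 0))] /=.
  by rewrite coefCM coef1 /= => pq; apply/unitrPr; exists q`_0.
have divCMXn c i f : divides p c -> divides p%:P f ->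
    divides p%:P (f + c *: 'X^i).
  case=> r -> [q ->]; exists (q + r *: 'X^i).
  by rewrite mulrDl [_ *: _ * _]mulrC mul_polyC scalerA [p * r]mulrC.
have lead_dec f : f = (f - lead_coef f *: 'X^((size f).-1))
                      + lead_coef f *: 'X^((size f).-1) by rewrite subrK.
have size_dec f : f != 0 ->
    (size (f - lead_coef f *: 'X^((size f).-1))%R < size f)%N.
  move=> f0; have szf : (0 < size f)%N by rewrite size_poly_gt0.
  rewrite -(prednK szf) ltnS; apply/leq_sizeP => j.
  rewrite leq_eqVlt coefB coefZ coefXn => /orP[/eqP <-|ltj].
    by rewrite eqxx mulr1 lead_coefE subrr.
  rewrite gtn_eqF // mulr0 subr0 nth_default //.
  by rewrite -(prednK szf).
move=> f g; have [k] := ubnP (size f + size g).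
elim: k f g => // k IHk f g lek [q e].
have [->|f0] := eqVneq f 0; first by left; exists 0; rewrite mul0r.
have [->|g0] := eqVneq g 0; first by right; exists 0; rewrite mul0r.
have [] : divides p (lead_coef f) \/ divides p (lead_coef g).
  by apply: pdiv; exists (lead_coef q); rewrite -lead_coefM e lead_coefM lead_coefC.
- move=> pf; have [] := IHk (f - lead_coef f *: 'X^((size f).-1)) g.
  + by rewrite -ltnS (leq_trans _ lek) // ltnS ltn_add2r size_dec.
  + case: pf => r fE; exists (q - r *: 'X^((size f).-1) * g).
    rewrite !mulrBl -e fE; congr (_ - _).
    by rewrite -mul_polyC -[r *: _]mul_polyC polyCM; ring.
  + by left; rewrite (lead_dec f); apply: divCMXn.
  by right.
move=> pg; have [] := IHk f (g - lead_coef g *: 'X^((size g).-1)).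
- by rewrite -ltnS (leq_trans _ lek) // ltnS ltn_add2l size_dec.
- case: pg => r gE; exists (q - r *: 'X^((size g).-1) * f).
  rewrite mulrBr mulrBl -e gE; congr (_ - _).
  by rewrite -mul_polyC -[r *: _]mul_polyC polyCM; ring.
- by left.
by right; rewrite (lead_dec g); apply: divCMXn.
Qed.

(** Testing divisibility by primes of R avoids forming a content or a gcd of the coefficients. *)
Definition primitive_poly f :=
  forall p, prime_elt p -> ~ divides p%:P f.

Lemma primitive_divides g f : primitive_poly g -> divides f g ->
  primitive_poly f.
Proof.
move=> pg [q gE] p pp [r fE]; apply: (pg p pp).
by exists (q * r); rewrite gE fE mulrA.
Qed.

(** The primes of c are removed one by one: each stays prime among polynomials and divides q * f but
    not f, so it divides the cofactor q. *)
Lemma primitive_dividesZ c f g : c != 0 -> primitive_poly f ->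
  divides f (c%:P * g) -> divides f g.
Proof.
move=> c0 pf; have [l lc] := factR c0.
elim: l c {c0} lc g => [|l IHl] c lc g [q e].
  have cu := prime_factors0 lc.
  by exists (c^-1%:P * q); rewrite -mulrA -e mulrA -polyCM mulVr // mul1r.
have [p [b [pp lb cE]]] := prime_factorsS lc.
have [p0 _ pdiv] := prime_polyC pp.
have [] : divides p%:P q \/ divides p%:P f.
- by apply: pdiv; exists (b%:P * g); rewrite -e cE polyCM; ring.
- case=> r qE; apply: (IHl b lb); exists r.
  apply: (mulfI p0).
  transitivity (c%:P * g); first by rewrite cE polyCM; ring.
  by rewrite e qE; ring.
by move=> /(pf p pp).
Qed.

(* [Pdiv.Idomain.dvdp] is divisibility up to a nonzero constant, that is, over
   the fraction field of R: this is Gauss's lemma. *)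
Lemma primitive_dividesp f g : primitive_poly f -> Pdiv.Idomain.dvdp f g ->
  divides f g.
Proof.
move=> pf /Pdiv.Idomain.dvdpP[[c q] /= c0 e].
by apply: (primitive_dividesZ c0 pf); exists q; rewrite mul_polyC.
Qed.

(** Each prime of R extracted from f also leaves the factorization of its leading coefficient, so
    the extraction stops. *)
Lemma primitive_part f : f != 0 ->
  exists c g, [/\ c != 0, primitive_poly g & f = c%:P * g].
Proof.
rewrite -lead_coef_eq0 => /factR[l].
elim: l f => [|l IHl] f lf.
  exists 1, f; rewrite oner_eq0 mul1r; split => // p [_ pu _] [q fE].
  case/negP: pu; apply: divides_unit (prime_factors0 lf).
  by exists (lead_coef q); rewrite fE lead_coefM lead_coefC.
have [[p [pp [q fE]]]|prf] := EM (exists p, prime_elt p /\ divides p%:P f).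
  have [|c [g [c0 pg qE]]] := IHl q.
    move: lf; rewrite fE lead_coefM lead_coefC mulrC.
    by case/(prime_factors_div pp) => _ [<-].
  have [p0 _ _] := pp.
  by exists (c * p), g; rewrite mulf_neq0 // fE qE polyCM mulrAC.
exists 1, f; rewrite oner_eq0 mul1r; split => // p pp pf; apply: prf.
by exists p.
Qed.

Lemma primitive_size1 f : primitive_poly f -> size f = 1%N ->
  f \is a GRing.unit.
Proof.
move=> pf /eqP/size_poly1P[c c0 fE]; have [l] := factR c0.
case: l => [|l] lc.
  by rewrite fE; apply: rmorph_unit; apply: prime_factors0.
have [p [b [pp _ cE]]] := prime_factorsS lc.
by case: (pf p pp); exists b%:P; rewrite fE cE -polyCM mulrC.
Qed.

(** Let d be the primitive part of the gcd of f and g over the fraction field; it divides f over R.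
    Either the cofactor is constant, hence a unit, and f divides g with d; or d is constant, f and g
    are coprime over the fraction field, and f divides h. *)
Lemma primitive_irreducible_prime f : primitive_poly f -> (1 < size f)%N ->
  (forall g h, f = g * h -> size g = 1%N \/ size h = 1%N) -> prime_elt f.
Proof.
move=> pf szf irrf; have f0 : f != 0 by rewrite -size_poly_gt0 ltnW.
split => //.
  by apply: contraL szf; rewrite poly_unitE => /andP[/eqP->].
move=> g h [q e].
have dvdpM : Pdiv.Idomain.dvdp f (g * h).
  by apply/Pdiv.Idomain.dvdpP; exists (1, q); rewrite ?oner_eq0 //= scale1r.
have [|c [d [c0 pd dE]]] := @primitive_part (Pdiv.Idomain.gcdp f g).
  by rewrite Pdiv.Idomain.gcdp_eq0 negb_and f0.
have dvd_d k : Pdiv.Idomain.dvdp (Pdiv.Idomain.gcdp f g) k -> divides d k.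
  case/Pdiv.Idomain.dvdpP => -[a r] /= a0 e'; apply: (primitive_dividesZ a0 pd).
  by exists (r * c%:P); rewrite mul_polyC e' dE mulrA.
have [q' fE] : divides d f by apply: dvd_d; apply: Pdiv.Idomain.dvdp_gcdl.
have [szq|szd] := irrf _ _ fE.
  have qu : q' \is a GRing.unit.
    apply: primitive_size1 => //; apply: primitive_divides pf _.
    by exists d; rewrite mulrC.
  have [r gE] : divides d g by apply: dvd_d; apply: Pdiv.Idomain.dvdp_gcdr.
  by left; exists (r / q'); rewrite fE gE -mulrA mulKr.
right; apply: primitive_dividesp => //.
rewrite -(@Pdiv.Idomain.Gauss_dvdpr _ _ g) //.
rewrite Pdiv.Idomain.coprimep_def dE mul_polyC size_scale //.
by apply/eqP.
Qed.

Lemma primitive_poly_factor f : primitive_poly f -> f != 0 ->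
  exists l, prime_factors l f.
Proof.
have [k] := ubnP (size f); elim: k f => // k IHk f szk pf f0.
have [szf|szf] := leqP (size f) 1.
  have sz1 : size f = 1%N by apply/eqP; rewrite eqn_leq szf size_poly_gt0.
  by exists 0, f, [::]; split; rewrite ?big_nil ?mulr1 // primitive_size1.
have [[g [h [fE szg szh]]]|irrf] :=
    EM (exists g h, [/\ f = g * h, size g <> 1%N & size h <> 1%N]); last first.
  exists 1%N, 1, [:: f]; rewrite unitr1 big_seq1 mul1r; split => // q.
  rewrite inE => /eqP ->; apply: primitive_irreducible_prime => // g h fE.
  have [?|/eqP szg] := eqVneq (size g) 1%N; first by left.
  have [?|/eqP szh] := eqVneq (size h) 1%N; first by right.
  by case: irrf; exists g, h.
have /norP[g0 h0] : ~~ ((g == 0) || (h == 0)) by rewrite -mulf_eq0 -fE.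
have size2 (r : {poly R}) : r != 0 -> size r <> 1%N -> (1 < size r)%N.
  by rewrite -size_poly_gt0; case: (size r) => [|[]].
have sE : size f = (size g + size h).-1 by rewrite fE size_mul.
have := size2 g g0 szg; have := size2 h h0 szh => sh sg.
have [||lg [u [s [uu ps _ gE]]]] := IHk g _ _ g0.
- by move: szk; rewrite sE; lia.
- by apply: primitive_divides pf _; exists h; rewrite fE mulrC.
have [||lh [v [t [vu pt _ hE]]]] := IHk h _ _ h0.
- by move: szk; rewrite sE; lia.
- by apply: primitive_divides pf _; exists g.
exists (size (s ++ t)), (u * v), (s ++ t); rewrite unitrM uu vu big_cat /=.
split => //; last by rewrite fE gE hE; ring.
by move=> p; rewrite mem_cat => /orP[/ps|/pt].
Qed.

Lemma factorial_poly : factorial_ring {poly R}.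
Proof.
move=> f f0; have [c [g [c0 pg fE]]] := primitive_part f0.
have [l] := factR c0.
have g0 : g != 0 by apply: contraNneq f0 => g0; rewrite fE g0 mulr0.
have [l' lg] := primitive_poly_factor pg g0.
rewrite fE; elim: l c {c0 fE} => [|l IHl] c lc.
  exists l'; apply: prime_factorsZ => //; apply: rmorph_unit.
  exact: prime_factors0.
have [p [b [pp lb ->]]] := prime_factorsS lc.
have [m lm] := IHl b lb; exists m.+1; rewrite polyCM -mulrA.
by apply: prime_factorsM => //; apply: prime_polyC.
Qed.

End PolyFactorial.

(** * Unique factorization in several variables *)

Section MpolyFactorial.
Variable K : fieldType.

Lemma mpoly_unitC n (c : K) : c != 0 -> c%:MP_[n] \is a GRing.unit.
Proof.
by move=> c0; apply/unitrPr; exists c^-1%:MP; rewrite -mpolyCM divff // mpolyC1.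
Qed.

Lemma mpoly_unit_constant n (p : {mpoly K[n]}) :
  p \is a GRing.unit -> p = (p@_0%MM)%:MP.
Proof. by case/andP => /eqP. Qed.

Lemma factorial_mpoly n : factorial_ring {mpoly K[n]}.
Proof.
elim: n => [|n IHn].
  move=> p p0; exists 0%N, p, [::]; rewrite big_nil mulr1; split => //.
  have pE : p = (p@_0%MM)%:MP.
    apply/mpolyP => m; rewrite mcoeffC.
    have -> : m = 0%MM by apply/mnmP => -[].
    by rewrite eqxx mulr1.
  rewrite pE mpoly_unitC //; apply: contraNneq p0 => p00.
  by rewrite pE p00 mpolyC0.
(* [muni] turns the last variable into that of a univariate polynomial over the first n; [restr] and
   [comb] split and rejoin exponents accordingly, which shows that [muni] is bijective. *)
pose widen := widen_ord (leqnSn n).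
pose restr (m : 'X_{1..n.+1}) : 'X_{1..n} := [multinom m (widen i) | i < n].
pose comb (m : 'X_{1..n}) k : 'X_{1..n.+1} :=
  [multinom (if unlift ord_max i is Some j then m j else k) | i < n.+1].
have widenE i : widen i = lift ord_max i.
  by apply: val_inj; rewrite /= /bump leqNgt ltn_ord.
have restrK m : comb (restr m) (m ord_max) = m.
  apply/mnmP => i; rewrite mnmE; case: unliftP => [j ->|-> //].
  by rewrite mnmE widenE.
have combK m k : restr (comb m k) = m.
  by apply/mnmP => i; rewrite !mnmE widenE liftK.
have comb_max m k : comb m k ord_max = k by rewrite mnmE unlift_none.
have combE m' m k : (m' == comb m k) = (restr m' == m) && (m' ord_max == k).
  apply/eqP/andP => [->|[/eqP <- /eqP <-]]; last by rewrite restrK.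
  by rewrite combK comb_max.
have muni_coef (p : {mpoly K[n.+1]}) m k : (muni p)`_k@_m = p@_(comb m k).
  rewrite muniE coef_sum raddf_sum /= [in RHS](mpolyE p) raddf_sum /=.
  apply: eq_bigr => m' _.
  rewrite coefZ coefXn mcoeffZ [in RHS]mcoeffX combE eq_sym.
  rewrite -/restr.
  case: eqVneq => _; rewrite ?andbF ?andbT /= ?mulr1 ?mulr0 ?mcoeff0 //.
  by rewrite mcoeffZ mcoeffX.
apply: (@factorial_ring_iso {poly {mpoly K[n]}} {mpoly K[n.+1]} (@muni n K))
  (factorial_poly IHn).
- apply: raddf_inj => p p0; apply/mpolyP => m.
  by rewrite -(restrK m) -muni_coef p0 coef0 !mcoeff0.
move=> q; exists (\sum_(i < size q) \sum_(m <- msupp q`_i)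
                    q`_i@_m *: 'X_[comb m i]).
have muniX m k : muni 'X_[comb m k] = 'X_[m] *: 'X^k :> {poly {mpoly K[n]}}.
  apply/polyP => k'; apply/mpolyP => m'.
  rewrite muni_coef coefZ coefXn mcoeffX eq_sym combE combK comb_max.
  case: (k' =P k) => _; rewrite ?andbF ?andbT ?mulr0 ?mcoeff0 //.
  by rewrite mulr1 mcoeffX eq_sym.

rewrite -[RHS]coefK poly_def raddf_sum; apply: eq_bigr => i _.
rewrite {3}(mpolyE q`_i) scaler_suml raddf_sum; apply: eq_bigr => m _.
by rewrite /= muniZ muniX scalerA mul_mpolyC.
Qed.

End MpolyFactorial.

(** * The algebra of formal power series *)

Section FpsRing.
Variables (K : fieldType) (n : nat).
Implicit Types (f g h : fps K n) (p q : {mpoly K[n]}).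

HB.instance Definition _ := gen_eqMixin (fps K n).
HB.instance Definition _ := gen_choiceMixin (fps K n).

Fact fps_addrA : associative (fun f g => (fun m => f m + g m) : fps K n).
Proof. by move=> f g h; apply: funext => m; rewrite addrA. Qed.
Fact fps_addrC : commutative (fun f g => (fun m => f m + g m) : fps K n).
Proof. by move=> f g; apply: funext => m; rewrite addrC. Qed.
Fact fps_add0r :
  left_id ((fun=> 0) : fps K n) (fun f g => (fun m => f m + g m) : fps K n).
Proof. by move=> f; apply: funext => m; rewrite add0r. Qed.
Fact fps_addNr : left_inverse ((fun=> 0) : fps K n)
  (fun f => (fun m => - f m) : fps K n)
  (fun f g => (fun m => f m + g m) : fps K n).
Proof. by move=> f; apply: funext => m; rewrite addNr. Qed.

HB.instance Definition _ := GRing.isZmodule.Build (fps K n)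
  fps_addrA fps_addrC fps_add0r fps_addNr.

Lemma fps_addE f g m : (f + g) m = f m + g m. Proof. by []. Qed.
Lemma fps_oppE f m : (- f) m = - f m. Proof. by []. Qed.
Lemma fps_sumE I (r : seq I) (P : pred I) (F : I -> fps K n) m :
  (\sum_(i <- r | P i) F i) m = \sum_(i <- r | P i) F i m.
Proof. by elim/big_rec2: _ => [|i x y _ <-]. Qed.

Lemma mcoeff_fps_trunc e f m : (mdeg m <= e)%N -> (fps_trunc e f)@_m = f m.
Proof. exact: (@mcoeff_mpoly n K f m e.+1). Qed.

(** Coefficients of degree at most e of a product involve only such coefficients of the factors. The
    ring laws of series thus reduce to those of polynomials. *)
Lemma fps_mul_mpoly e f g p q :
  (forall m, (mdeg m <= e)%N -> f m = p@_m) ->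
  (forall m, (mdeg m <= e)%N -> g m = q@_m) ->
  forall m, (mdeg m <= e)%N -> fps_mul f g m = (p * q)@_m.
Proof.
move=> fp gq m lme; rewrite mcoeffM; apply: eq_bigr => k _.
by rewrite fp ?gq //; apply: leq_trans lme; rewrite -ltnS bmdeg.
Qed.

Fact fps_mulA : associative (@fps_mul K n).
Proof.
move=> f g h; apply: funext => m; pose T (u : fps K n) := fps_trunc (mdeg m) u.
have TE f' m' : (mdeg m' <= mdeg m)%N -> f' m' = (T f')@_m'.
  by move=> ?; rewrite mcoeff_fps_trunc.
transitivity (T f * (T g * T h))@_m.
  by apply: (@fps_mul_mpoly (mdeg m)) => //;
    [apply: TE|apply: fps_mul_mpoly => *; apply: TE].
by rewrite mulrA; symmetry; apply: (@fps_mul_mpoly (mdeg m)) => //;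
  [apply: fps_mul_mpoly => *; apply: TE|apply: TE].
Qed.

Fact fps_mulC : commutative (@fps_mul K n).
Proof.
move=> f g; apply: funext => m; pose T (u : fps K n) := fps_trunc (mdeg m) u.
have TE f' m' : (mdeg m' <= mdeg m)%N -> f' m' = (T f')@_m'.
  by move=> ?; rewrite mcoeff_fps_trunc.
by rewrite (@fps_mul_mpoly (mdeg m) f g _ _ (TE f) (TE g)) // mulrC
           -(@fps_mul_mpoly (mdeg m) g f _ _ (TE g) (TE f)).
Qed.

Fact fps_mul1 : left_id (fps_of_mpoly (1 : {mpoly K[n]})) (@fps_mul K n).
Proof.
move=> f; apply: funext => m.
rewrite (@fps_mul_mpoly (mdeg m) _ f 1 (fps_trunc (mdeg m) f)) //.
  by rewrite mul1r mcoeff_fps_trunc.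
by move=> m' ?; rewrite mcoeff_fps_trunc.
Qed.

Fact fps_mulDl : left_distributive (@fps_mul K n) +%R.
Proof.
move=> f g h; apply: funext => m.
rewrite [RHS]fps_addE /fps_mul -big_split.
by apply: eq_bigr => k _; rewrite fps_addE mulrDl.
Qed.

Fact fps_1_neq0 : fps_of_mpoly (1 : {mpoly K[n]}) != 0.
Proof.
apply/eqP => /(congr1 (fun f => f 0%MM)) /eqP.
by rewrite /fps_of_mpoly mcoeff1 eqxx oner_eq0.
Qed.

HB.instance Definition _ := GRing.Zmodule_isComNzRing.Build (fps K n)
  fps_mulA fps_mulC fps_mul1 fps_mulDl fps_1_neq0.

Definition fps_scale (c : K) f : fps K n := fun m => c * f m.

Fact fps_scaleA a b f : fps_scale a (fps_scale b f) = fps_scale (a * b) f.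
Proof. by apply: funext => m; rewrite /fps_scale mulrA. Qed.
Fact fps_scale1 : left_id 1 fps_scale.
Proof. by move=> f; apply: funext => m; rewrite /fps_scale mul1r. Qed.
Fact fps_scaleDr : right_distributive fps_scale +%R.
Proof. by move=> c f g; apply: funext => m; rewrite /fps_scale mulrDr. Qed.
Fact fps_scaleDl f : {morph fps_scale^~ f : a b / a + b}.
Proof. by move=> a b; apply: funext => m; rewrite /fps_scale mulrDl. Qed.

HB.instance Definition _ := GRing.Zmodule_isLmodule.Build K (fps K n)
  fps_scaleA fps_scale1 fps_scaleDr fps_scaleDl.

Lemma fps_scaleE c f m : (c *: f) m = c * f m. Proof. by []. Qed.

Fact fps_scaleAl c f g : c *: (f * g) = c *: f * g.
Proof.
apply: funext => m; rewrite fps_scaleE [LHS]mulr_sumr.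
by apply: eq_bigr => k _; rewrite mulrA.
Qed.

HB.instance Definition _ := GRing.Lmodule_isLalgebra.Build K (fps K n) fps_scaleAl.
HB.instance Definition _ := GRing.Lalgebra_isComAlgebra.Build K (fps K n).

Fact fps_of_mpoly_is_linear : linear (@fps_of_mpoly K n).
Proof. by move=> c p q; apply: funext => m; rewrite /fps_of_mpoly linearP. Qed.
HB.instance Definition _ := GRing.isLinear.Build K {mpoly K[n]} (fps K n) _
  (@fps_of_mpoly K n) fps_of_mpoly_is_linear.

Fact fps_of_mpoly_is_monoid_morphism : monoid_morphism (@fps_of_mpoly K n).
Proof.
split=> // p q; apply: funext => m.
by rewrite /fps_of_mpoly [RHS](@fps_mul_mpoly (mdeg m) _ _ p q).
Qed.
HB.instance Definition _ := GRing.isMonoidMorphism.Build {mpoly K[n]} (fps K n)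
  (@fps_of_mpoly K n) fps_of_mpoly_is_monoid_morphism.

(** Membership in the e-th power of the maximal ideal. Congruences modulo these powers, together
    with [fps_ord_inf], play the role of the topology. *)
Definition fps_ord e f := forall m, (mdeg m < e)%N -> f m = 0.

Lemma fps_ord_leq d e f : (d <= e)%N -> fps_ord e f -> fps_ord d f.
Proof. by move=> le_de f0 m ltm; apply: f0; apply: leq_trans le_de. Qed.

Lemma fps_ordD e f g : fps_ord e f -> fps_ord e g -> fps_ord e (f + g).
Proof. by move=> f0 g0 m lem; rewrite fps_addE f0 ?g0 ?addr0. Qed.

Lemma fps_ordN e f : fps_ord e f -> fps_ord e (- f).
Proof. by move=> f0 m lem; rewrite fps_oppE f0 ?oppr0. Qed.

Lemma fps_ordB e f g : fps_ord e f -> fps_ord e g -> fps_ord e (f - g).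
Proof. by move=> f0 g0; apply: fps_ordD => //; apply: fps_ordN. Qed.

Lemma fps_ordZ e c f : fps_ord e f -> fps_ord e (c *: f).
Proof. by move=> f0 m lem; rewrite fps_scaleE f0 ?mulr0. Qed.

Lemma fps_ord_sum e I (r : seq I) (P : pred I) (F : I -> fps K n) :
  (forall i, P i -> fps_ord e (F i)) -> fps_ord e (\sum_(i <- r | P i) F i).
Proof. by move=> F0; elim/big_ind: _ => //; apply: fps_ordD. Qed.

Lemma fps_ordM d e f g : fps_ord d f -> fps_ord e g -> fps_ord (d + e) (f * g).
Proof.
move=> f0 g0 m ltm.
have fg0 a b : m = (a + b)%MM -> f a * g b = 0.
  move=> mE; have [/f0->|lea] := ltnP (mdeg a) d; first by rewrite mul0r.
  rewrite g0 ?mulr0 // -(ltn_add2l d); apply: leq_ltn_trans ltm.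
  by rewrite mE mdegD leq_add2r.
by apply: big1 => k /eqP /fg0.
Qed.

Lemma fps_ord_inf f : (forall e, fps_ord e f) -> f = 0.
Proof. by move=> f0; apply: funext => m; apply: (f0 (mdeg m).+1). Qed.

Lemma fps_ord_trunc e f : fps_ord e.+1 (f - fps_of_mpoly (fps_trunc e f)).
Proof.
move=> m lem; rewrite fps_addE fps_oppE /fps_of_mpoly.
by rewrite mcoeff_fps_trunc // subrr.
Qed.

End FpsRing.

(** * Substitution *)

Section Substitution.
Variables (K : fieldType) (n : nat).
Implicit Types (f g h : fps K n) (p q : {mpoly K[n]}) (F G : fmap K n).

Lemma fps_ord_congrM e f f' g g' : fps_ord e (f - f') -> fps_ord e (g - g') ->
  fps_ord e (f * g - f' * g').
Proof.
move=> ff gg; have -> : f * g - f' * g' = (f - f') * g + f' * (g - g') by ring.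
apply: fps_ordD; first by rewrite -[e]addn0; apply: fps_ordM.
by apply: (@fps_ordM _ _ 0).
Qed.

Lemma fps_ord_prod (d : 'I_n -> nat) F :
  (forall i, fps_ord (d i) (F i)) -> fps_ord (\sum_i d i) (\prod_i F i).
Proof. by move=> F0; elim/big_rec2: _ => // i e f _; apply: fps_ordM. Qed.

Lemma fps_ordX d e f : fps_ord d f -> fps_ord (d * e) (f ^+ e).
Proof.
move=> f0; elim: e => [|e IHe]; first by rewrite muln0.
by rewrite mulnS exprS; apply: fps_ordM.
Qed.

(** Substitution into a polynomial without any truncation: a ring morphism by construction, from
    which the properties of [fps_comp] are transferred. *)
Definition msubst F : {mpoly K[n]} -> fps K n := mmap (in_alg (fps K n)) F.

HB.instance Definition _ F := GRing.RMorphism.on (msubst F).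

Lemma msubstU F i : msubst F 'X_i = F i.
Proof. by rewrite /msubst mmapX mmap1U. Qed.

Lemma msubstE F p :
  msubst F p = \sum_(m <- msupp p) p@_m *: \prod_i F i ^+ m i.
Proof. by apply: eq_bigr => m _; rewrite mulr_algl. Qed.

Lemma fps_of_mpoly_comp p (P : n.-tuple {mpoly K[n]}) :
  fps_of_mpoly (p \mPo P) = msubst (fun i => fps_of_mpoly (tnth P i)) p.
Proof.
rewrite comp_mpolyE msubstE linear_sum; apply: eq_bigr => m _.
rewrite linearZ /= rmorph_prod; congr (_ *: _).
by apply: eq_bigr => i _; rewrite rmorphXn.
Qed.

Lemma fps_ord_msubst e F p : (forall i, fps_ord 1 (F i)) ->
  fps_ord e (fps_of_mpoly p) -> fps_ord e (msubst F p).
Proof.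
move=> F0 p0; rewrite msubstE big_seq; apply: fps_ord_sum => m.
rewrite mcoeff_msupp => pm; apply: fps_ordZ.
have lem : (e <= mdeg m)%N by rewrite leqNgt; apply: contra pm => /p0/eqP.
apply: fps_ord_leq lem _; rewrite mdegE; apply: fps_ord_prod => i.
by rewrite -{1}[m i]mul1n; apply: fps_ordX.
Qed.

Lemma msubst_congr e F G p : (forall i, fps_ord e (F i - G i)) ->
  fps_ord e (msubst F p - msubst G p).
Proof.
move=> FG; rewrite !msubstE -sumrB; apply: fps_ord_sum => m _.
rewrite -scalerBr; apply: fps_ordZ; elim/big_rec2: _ => [|i f g _ fg].
  by rewrite subrr.
apply: fps_ord_congrM fg; elim: (m i) => [|k IHk]; first by rewrite subrr.
by rewrite !exprS; apply: fps_ord_congrM.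
Qed.

Lemma fps_ord_comp_msubst e f F p : (forall i, F i 0%MM = 0) ->
  fps_ord e (f - fps_of_mpoly p) -> fps_ord e (fps_comp f F - msubst F p).
Proof.
move=> F0 fp m lem; set d := mdeg m.
have F1 i : fps_ord 1 (F i).
  by move=> m'; rewrite ltnS leqn0 mdeg_eq0 => /eqP ->.
pose P := [tuple fps_trunc d (F i) | i < n].
pose FP i := fps_of_mpoly (tnth P i).
have F_FP i : fps_ord d.+1 (F i - FP i).
  by rewrite /FP tnth_mktuple; apply: fps_ord_trunc.
have FP1 i : fps_ord 1 (FP i).
  by rewrite -[FP i](subKr (F i)); apply: fps_ordB => //; apply: fps_ord_leq (F_FP i).
rewrite fps_addE fps_oppE.
have -> : fps_comp f F m = msubst FP (fps_trunc d f) m.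
  by rewrite -fps_of_mpoly_comp.
set A := msubst FP _; pose B := msubst FP (p - fps_trunc d f).
(* The first error comes from truncating F, the second from replacing p by the truncation of f; both
   have order greater than d, the degree of m. *)
have -> : msubst F p = A + (msubst F p - msubst FP p) + B.
  by rewrite /A /B rmorphB; ring.
have FPp : (msubst F p - msubst FP p) m = 0 by apply: msubst_congr F_FP _ _.
rewrite fps_addE [(A + _) m]fps_addE FPp [B m](@fps_ord_msubst d.+1) //.
  by ring.
move=> m' lem'; rewrite linearB /=.
have -> : fps_of_mpoly p - fps_of_mpoly (fps_trunc d f) =
  (f - fps_of_mpoly (fps_trunc d f)) - (f - fps_of_mpoly p) by ring.
rewrite fps_addE fps_oppE fps_ord_trunc // fp ?subrr //.
exact: leq_trans lem.
Qed.

Definition fps_subst F : fps K n -> fps K n := fun f => fps_comp f F.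

Fact fps_trunc_is_linear e : linear (@fps_trunc K n e).
Proof.
move=> c f g; apply/mpolyP => m; rewrite mcoeffD mcoeffZ.
case: (leqP (mdeg m) e) => lem; first by rewrite !mcoeff_fps_trunc.
by rewrite !raddf_sum /= !big1 ?mulr0 ?addr0 // => -[m' lem'] _ /=;
  rewrite mcoeffZ mcoeffX; case: eqP lem lem' => [->|];
  rewrite ?mulr0 // ltnS ltnNge => /negP.
Qed.
HB.instance Definition _ e := GRing.isLinear.Build K (fps K n) {mpoly K[n]} _
  (@fps_trunc K n e) (fps_trunc_is_linear e).

Fact fps_subst_is_linear F : linear (fps_subst F).
Proof.
move=> c f g; apply: funext => m.
by rewrite /fps_subst /fps_comp !linearP.
Qed.
HB.instance Definition _ F := GRing.isLinear.Build K (fps K n) (fps K n) _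
  (fps_subst F) (fps_subst_is_linear F).

Definition order_preserving (T : fps K n -> fps K n) :=
  forall e f, fps_ord e f -> fps_ord e (T f).

(* Order-preserving linear maps are continuous, hence determined by their
   values on polynomials. *)
Lemma fps_operator_ext (L M : {linear fps K n -> fps K n}) :
  order_preserving L -> order_preserving M -> L 1 = M 1 ->
  (forall i, L (@fmap_id K n i) = M (@fmap_id K n i)) ->
  (forall f g, L f = M f -> L g = M g -> L (f * g) = M (f * g)) ->
  forall f, L f = M f.
Proof.
move=> oL oM LM1 LMX LMM.
have LMp p : L (fps_of_mpoly p) = M (fps_of_mpoly p).
  rewrite (mpolyE p) !linear_sum; apply: eq_bigr => m _.
  rewrite !linearZ /=; congr (_ *: _); rewrite mpolyXE_id rmorph_prod /=.
  elim/big_rec: _ => // i f _ LMf; apply: (LMM) => //; rewrite rmorphXn /=.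
  by elim: (m i) => [|k IHk] //; rewrite exprS; apply: (LMM) => //; apply: LMX.
move=> f; apply/eqP; rewrite -subr_eq0; apply/eqP; apply: fps_ord_inf => e.
pose p := fps_of_mpoly (fps_trunc e f).
have -> : L f - M f = L (f - p) - M (f - p) by rewrite !linearB /= LMp; ring.
by apply: fps_ord_leq (leqnSn e) _; apply: fps_ordB;
  [apply: oL|apply: oM]; apply: fps_ord_trunc.
Qed.

Section FixedSubst.
Variable F : fmap K n.
Hypothesis F0 : forall i, F i 0%MM = 0.

Let F1 i : fps_ord 1 (F i).
Proof. by move=> m'; rewrite ltnS leqn0 mdeg_eq0 => /eqP ->. Qed.

Lemma fps_subst_mpoly p : fps_subst F (fps_of_mpoly p) = msubst F p.
Proof.
apply/eqP; rewrite -subr_eq0; apply/eqP; apply: fps_ord_inf => e.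
by apply: fps_ord_comp_msubst => //; rewrite subrr.
Qed.

Lemma fps_subst_order : order_preserving (fps_subst F).
Proof.
move=> [|e] f f0 //; rewrite -[fps_subst F f](subrK (msubst F (fps_trunc e f))).
have fT := @fps_ord_trunc K n e f.
apply: fps_ordD; first exact: fps_ord_comp_msubst.
apply: fps_ord_msubst => //.
by rewrite -[fps_of_mpoly _](subKr f); apply: fps_ordB.
Qed.

Lemma fps_subst1 : fps_subst F 1 = 1.
Proof. by rewrite (fps_subst_mpoly 1) rmorph1. Qed.

Lemma fps_substX i : fps_subst F (@fmap_id K n i) = F i.
Proof. by rewrite fps_subst_mpoly msubstU. Qed.

Lemma fps_substM f g : fps_subst F (f * g) = fps_subst F f * fps_subst F g.
Proof.
apply/eqP; rewrite -subr_eq0; apply/eqP; apply: fps_ord_inf => e.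
apply: fps_ord_leq (leqnSn e) _.
pose Tf := fps_trunc e f; pose Tg := fps_trunc e g.
have -> : fps_subst F (f * g) - fps_subst F f * fps_subst F g =
  (fps_subst F (f * g) - msubst F (Tf * Tg))
  - (fps_subst F f * fps_subst F g - msubst F Tf * msubst F Tg).
  by rewrite rmorphM; ring.
apply: fps_ordB.
  apply: fps_ord_comp_msubst => //; rewrite rmorphM.
  by apply: fps_ord_congrM; apply: fps_ord_trunc.
by apply: fps_ord_congrM; apply: fps_ord_comp_msubst => //; apply: fps_ord_trunc.
Qed.

End FixedSubst.

Lemma fmap_comp0 F G : (forall i, F i 0%MM = 0) -> (forall i, G i 0%MM = 0) ->
  forall i, fmap_comp F G i 0%MM = 0.
Proof.
move=> F0 G0 i; apply: (fps_subst_order G0 (e := 1)); last by rewrite mdeg0.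
by move=> m'; rewrite ltnS leqn0 mdeg_eq0 => /eqP ->.
Qed.

(** Both sides are continuous ring morphisms, so the coordinates decide. The order is reversed: the
    pullback by F o G applies that of F first. *)
Lemma fps_subst_comp F G f :
  (forall i, F i 0%MM = 0) -> (forall i, G i 0%MM = 0) ->
  fps_subst (fmap_comp F G) f = fps_subst G (fps_subst F f).
Proof.
move=> F0 G0; have FG0 := fmap_comp0 F0 G0.
apply: (@fps_operator_ext (fps_subst (fmap_comp F G)) (fps_subst G \o fps_subst F)) => /=.
- exact: fps_subst_order.
- by move=> e g g0; do 2 apply: fps_subst_order => //.
- by rewrite !fps_subst1.
- by move=> i; rewrite !fps_substX.
by move=> g h e1 e2; rewrite (fps_substM FG0) (fps_substM F0) (fps_substM G0) e1 e2.
Qed.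

Lemma fps_subst_id f : fps_subst (@fmap_id K n) f = f.
Proof.
have z0 i : @fmap_id K n i 0%MM = 0.
  by rewrite /fmap_id /fps_of_mpoly mcoeffX -mdeg_eq0 mdeg1.
apply: (@fps_operator_ext (fps_subst (@fmap_id K n)) idfun) => //=.
- exact: fps_subst_order.
- exact: fps_subst1.
- by move=> i; rewrite fps_substX.
by move=> g h; rewrite fps_substM // => -> ->.
Qed.

Lemma fmap_eq_subst F G : (forall i, F i 0%MM = 0) -> (forall i, G i 0%MM = 0) ->
  (forall f, fps_subst F f = fps_subst G f) -> F = G.
Proof.
by move=> F0 G0 FG; apply: funext => i; rewrite -fps_substX // FG fps_substX.
Qed.

End Substitution.

(** * Vector fields and their flows *)

Section VectorFields.
Variables (K : fieldType) (n : nat).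
Implicit Types (f g h : fps K n) (p q : {mpoly K[n]}) (F : fmap K n).
Implicit Types (X Y : fvect K n) (i : 'I_n).

Fact fps_diff_is_linear i : linear (@fps_diff K n i).
Proof.
move=> c f g; apply: funext => m.
by rewrite /fps_diff !fps_addE !fps_scaleE mulrnDl mulrnAr.
Qed.
HB.instance Definition _ i := GRing.isLinear.Build K (fps K n) (fps K n) _
  (@fps_diff K n i) (fps_diff_is_linear i).

Lemma fps_diff_mpoly i p : fps_diff i (fps_of_mpoly p) = fps_of_mpoly p^`M(i).
Proof. by apply: funext => m; rewrite /fps_of_mpoly mcoeff_deriv. Qed.

Lemma fps_ord_diff i e f : fps_ord e.+1 f -> fps_ord e (fps_diff i f).
Proof.
by move=> f0 m ltm; rewrite /fps_diff f0 ?mul0rn // mdegD mdeg1 addn1.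
Qed.

Lemma fps_diffM i f g :
  fps_diff i (f * g) = fps_diff i f * g + f * fps_diff i g.
Proof.
apply/eqP; rewrite -subr_eq0; apply/eqP; apply: fps_ord_inf => e.
pose p := fps_trunc e f; pose q := fps_trunc e g.
have fp := @fps_ord_trunc K n e f; have gq := @fps_ord_trunc K n e g.
have dfp : fps_ord e (fps_diff i f - fps_of_mpoly p^`M(i)).
  by rewrite -fps_diff_mpoly -linearB; apply: fps_ord_diff.
have dgq : fps_ord e (fps_diff i g - fps_of_mpoly q^`M(i)).
  by rewrite -fps_diff_mpoly -linearB; apply: fps_ord_diff.
have dpq : fps_ord e (fps_diff i (f * g) - fps_of_mpoly (p * q)^`M(i)).
  rewrite -fps_diff_mpoly -linearB; apply: fps_ord_diff.
  by rewrite rmorphM; apply: fps_ord_congrM.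
have l e' f' : fps_ord e'.+1 f' -> fps_ord e' f' by apply: fps_ord_leq.
have := fps_ordB dpq (fps_ordD (fps_ord_congrM dfp (l _ _ gq))
                               (fps_ord_congrM (l _ _ fp) dgq)).
by rewrite mderivM rmorphD !rmorphM; congr fps_ord; rewrite /=; ring.
Qed.

Lemma fvect_appE X f : fvect_app X f = \sum_i X i * fps_diff i f.
Proof. by apply: funext => m; rewrite fps_sumE. Qed.

Fact fvect_app_is_linear X : linear (@fvect_app K n X).
Proof.
move=> c f g; rewrite !fvect_appE scaler_sumr -big_split; apply: eq_bigr => i _.
by rewrite linearP mulrDr scalerAr.
Qed.
HB.instance Definition _ X := GRing.isLinear.Build K (fps K n) (fps K n) _
  (@fvect_app K n X) (fvect_app_is_linear X).

Lemma fvect_appM X f g :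
  fvect_app X (f * g) = fvect_app X f * g + f * fvect_app X g.
Proof.
rewrite !fvect_appE mulr_suml mulr_sumr -big_split; apply: eq_bigr => i _.
by rewrite fps_diffM /=; ring.
Qed.

Lemma fvect_appB X Y f :
  fvect_app (fun i => X i - Y i) f = fvect_app X f - fvect_app Y f.
Proof.
by rewrite !fvect_appE -sumrB; apply: eq_bigr => i _; rewrite mulrBl.
Qed.

Lemma fvect_appZ c X f : fvect_app (fun i => c *: X i) f = c *: fvect_app X f.
Proof.
by rewrite !fvect_appE scaler_sumr; apply: eq_bigr => i _; rewrite -scalerAl.
Qed.

Lemma fvect_app1 X : fvect_app X 1 = 0.
Proof.
by have := fvect_appM X 1 1; rewrite !mulr1 mul1r -{1}[fvect_app X 1]addr0 => /addrI.
Qed.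

Lemma mderivXU i j : ('X_j : {mpoly K[n]})^`M(i) = (i == j)%:R.
Proof.
rewrite mderivX mnm1E eq_sym; case: eqP => [<-|_]; last by rewrite scale0r.
have -> : (U_(i) - U_(i) = 0 :> 'X_{1..n})%MM.
  by apply/mnmP => k; rewrite mnmBE mnm0E subnn.
by rewrite scale1r mpolyX0.
Qed.

Lemma fps_diff_id i j : fps_diff i (@fmap_id K n j) = (i == j)%:R.
Proof. by rewrite fps_diff_mpoly mderivXU rmorph_nat. Qed.

Lemma fvect_app_id X i : fvect_app X (@fmap_id K n i) = X i.
Proof.
rewrite fvect_appE (bigD1 i) //= fps_diff_id eqxx mulr1 big1 ?addr0 // => j ji.
by rewrite fps_diff_id (negbTE ji) mulr0.
Qed.

Lemma fps_ord_app r X a f : (forall i, fps_ord r.+1 (X i)) -> fps_ord a f ->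
  fps_ord (a + r) (fvect_app X f).
Proof.
move=> X0 f0; rewrite fvect_appE; apply: fps_ord_sum => i _.
(* For a = 0 differentiation cannot lower the order any further, and the bound holds with one degree
   to spare. *)
case: a f0 => [|a] f0.
  by apply: fps_ord_leq (leqnSn r) _; rewrite -[r.+1]addn0; apply: fps_ordM.
by rewrite addSnnS addnC; apply: fps_ordM => //; apply: fps_ord_diff.
Qed.

Lemma fps_ord_iter_app X a f j : (forall i, fps_ord 2 (X i)) -> fps_ord a f ->
  fps_ord (a + j) (iter j (fvect_app X) f).
Proof.
move=> X0 f0; elim: j => [|j IHj]; first by rewrite addn0.
by rewrite addnS -addn1 /=; apply: (@fps_ord_app 1).
Qed.

(* The action of the flow e^X on series: [fvect_exp X i] is by definition
   [fps_flow X z_i]. *)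
Definition fps_flow X f : fps K n := fun m =>
  \sum_(j < (mdeg m).+1) iter j (fvect_app X) f m / j`!%:R.

Lemma iter_fvect_app_is_linear X j : linear (iter j (@fvect_app K n X)).
Proof. by elim: j => [|j IHj] c f g //=; rewrite IHj linearP. Qed.
HB.instance Definition _ X j := GRing.isLinear.Build K (fps K n) (fps K n) _
  (iter j (@fvect_app K n X)) (iter_fvect_app_is_linear X j).

Fact fps_flow_is_linear X : linear (fps_flow X).
Proof.
move=> c f g; apply: funext => m.
rewrite /fps_flow fps_addE fps_scaleE mulr_sumr -big_split; apply: eq_bigr => j _.
by rewrite iter_fvect_app_is_linear fps_addE fps_scaleE mulrDl mulrA.
Qed.
HB.instance Definition _ X := GRing.isLinear.Build K (fps K n) (fps K n) _
  (fps_flow X) (fps_flow_is_linear X).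

(** The divided power X^j / j!, for which the Leibniz formula has no binomial coefficients. *)
Definition app_divpow X j f : fps K n := j`!%:R^-1 *: iter j (fvect_app X) f.

Section Order2.
Variable X : fvect K n.
Hypothesis X2 : forall i, fps_ord 2 (X i).

Lemma fps_ord_divpow a f j : fps_ord a f -> fps_ord (a + j) (app_divpow X j f).
Proof. by move=> f0; apply: fps_ordZ; apply: fps_ord_iter_app. Qed.

Lemma fps_flow_approx e N f : (e <= N)%N ->
  fps_ord e (fps_flow X f - \sum_(j < N) app_divpow X j f).
Proof.
move=> leN m ltm; have ltN := leq_trans ltm leN.
rewrite fps_addE fps_oppE fps_sumE /fps_flow.
rewrite (big_ord_widen N (fun j => iter j (fvect_app X) f m / j`!%:R)) //.
rewrite [X in _ - X](bigID (fun j : 'I_N => (j < (mdeg m).+1)%N)) /=.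
rewrite [X in _ - (_ + X)]big1 ?addr0 => [|j].
  by rewrite -sumrB big1 // => j _; rewrite /app_divpow fps_scaleE mulrC subrr.
rewrite -leqNgt => ltj.
by rewrite /app_divpow fps_scaleE (@fps_ord_iter_app X 0) ?mulr0.
Qed.

Lemma fps_flow_order : order_preserving (fps_flow X).
Proof.
move=> e f f0; rewrite -[fps_flow X f](subrK (\sum_(j < e) app_divpow X j f)).
apply: fps_ordD; first exact: fps_flow_approx.
by apply: fps_ord_sum => j _; apply: fps_ord_leq (leq_addr j e) _; apply: fps_ord_divpow.
Qed.

Hypothesis charK : [pchar K] =i pred0.

Lemma natr_pchar0_neq0 k : k.+1%:R != 0 :> K.
Proof. by have/pcharf0P->:= charK. Qed.

Lemma app_divpowS j f :
  fvect_app X (app_divpow X j f) = j.+1%:R *: app_divpow X j.+1 f.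
Proof.
rewrite linearZ /= /app_divpow scalerA iterS factS natrM invfM mulrA.
by rewrite divff ?mul1r // natr_pchar0_neq0.
Qed.

(** Applying X to the formula for k multiplies the left side by k + 1; on the right, the term of
    index i receives i from one sum and k + 1 - i from the other. *)
Lemma app_divpowM k f g : app_divpow X k (f * g) =
  \sum_(i < k.+1) app_divpow X i f * app_divpow X (k - i) g.
Proof.
elim: k => [|k IHk].
  by rewrite big_ord_recl big_ord0 addr0 /app_divpow fact0 invr1 !scale1r.
apply: (scalerI (natr_pchar0_neq0 k)).
rewrite -app_divpowS IHk linear_sum /=.
under eq_bigr => i _.
  rewrite fvect_appM !app_divpowS -(scalerAl i.+1%:R) -(scalerAr (k - i).+1%:R).
  over.
rewrite big_split /=.
have -> : \sum_(i < k.+1) i.+1%:R *: (app_divpow X i.+1 f * app_divpow X (k - i) g)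
  = \sum_(i < k.+2) i%:R *: (app_divpow X i f * app_divpow X (k.+1 - i) g).
  by rewrite [RHS]big_ord_recl scale0r add0r; apply: eq_bigr.
have -> : \sum_(i < k.+1) (k - i).+1%:R *: (app_divpow X i f * app_divpow X (k - i).+1 g)
  = \sum_(i < k.+2) (k.+1 - i)%:R *: (app_divpow X i f * app_divpow X (k.+1 - i) g).
  rewrite [RHS]big_ord_recr /= subnn scale0r addr0; apply: eq_bigr => i _.
  by rewrite subSn // -ltnS.
rewrite -big_split scaler_sumr; apply: eq_bigr => i _ /=.
by rewrite -scalerDl -natrD subnKC // -ltnS.
Qed.

Lemma fps_flow1 : fps_flow X 1 = 1.
Proof.
apply/eqP; rewrite -subr_eq0; apply/eqP; apply: fps_ord_inf => e.
apply: fps_ord_leq (leqnSn e) _.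
have divpow1 : \sum_(j < e.+1) app_divpow X j 1 = 1.
  rewrite big_ord_recl big1 ?addr0 => [|j _].
    by rewrite /app_divpow fact0 invr1 scale1r.
  by rewrite /app_divpow iterSr fvect_app1 !linear0.
by have := fps_flow_approx 1 (leqnn e.+1); rewrite divpow1.
Qed.

Lemma fps_flowM f g : fps_flow X (f * g) = fps_flow X f * fps_flow X g.
Proof.
apply/eqP; rewrite -subr_eq0; apply/eqP; apply: fps_ord_inf => e.
(* The Cauchy product of the two exponential series is the product of the
   polynomials P f and P g, evaluated at 1. *)
pose P u : {poly fps K n} := \poly_(i < e) app_divpow X i u.
have P1 u : (P u).[1] = \sum_(i < e) app_divpow X i u.
  by rewrite horner_poly; apply: eq_bigr => i _; rewrite expr1n mulr1.
have flowP u := @fps_flow_approx e e u (leqnn e).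
have PM : fps_ord e (\sum_(i < e) app_divpow X i (f * g) - (P f * P g).[1]).
  have szPM : (size (P f * P g)%R <= e + e)%N.
    apply: leq_trans (size_polyMleq _ _) _.
    by apply: leq_trans (leq_pred _) _; apply: leq_add; apply: size_poly.
  (* Below index e the coefficients are those of the Leibniz formula; from e on, they are sums of
     products of total order at least e. *)
  rewrite (horner_coef_wide _ szPM) big_split_ord opprD addrA /=.
  apply: fps_ordB.
    rewrite -sumrB big1 // => k _; rewrite expr1n mulr1 coefM app_divpowM -sumrB.
    apply: big1 => i _; rewrite !coef_poly.
    rewrite (leq_trans (ltn_ord i) (ltn_ord k)).
    by rewrite (leq_ltn_trans (leq_subr i k) (ltn_ord k)) subrr.
  apply: fps_ord_sum => k _; rewrite expr1n mulr1 coefM.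
  apply: fps_ord_sum => i _; rewrite !coef_poly.
  case: ifP => _; last by rewrite mul0r.
  case: ifP => _; last by rewrite mulr0.
  apply: (@fps_ord_leq _ _ e (i + (e + k - i))); last first.
    by apply: fps_ordM; apply: (@fps_ord_divpow 0).
  by rewrite subnKC ?leq_addr // -ltnS.
have := fps_ordB (fps_ordD (flowP (f * g)) PM)
                 (fps_ord_congrM (flowP f) (flowP g)).
by congr fps_ord; rewrite hornerM !P1; ring.
Qed.

End Order2.
End VectorFields.

(** * Exponential and logarithm *)

Section ExpLog.
Variables (K : fieldType) (n : nat).
Hypothesis charK : [pchar K] =i pred0.
Implicit Types (f g h : fps K n) (p q : {mpoly K[n]}) (F : fmap K n).
Implicit Types (X Y : fvect K n) (i : 'I_n).
Implicit Types (T : {linear fps K n -> fps K n}).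

Notation zvar := (@fmap_id K n).

Lemma fps_ord1 f : f 0%MM = 0 -> fps_ord 1 f.
Proof. by move=> f0 m; rewrite ltnS leqn0 mdeg_eq0 => /eqP ->. Qed.

Lemma fps_ord_id i : fps_ord 1 (zvar i).
Proof. by apply: fps_ord1; rewrite /fmap_id /fps_of_mpoly mcoeffX -mdeg_eq0 mdeg1. Qed.

Lemma fps_eq_ord f g : (forall e, fps_ord e (f - g)) -> f = g.
Proof. by move=> fg; apply/eqP; rewrite -subr_eq0; apply/eqP/fps_ord_inf. Qed.

Lemma fvect_exp0 X i : (forall i, fps_ord 2 (X i)) -> fvect_exp X i 0%MM = 0.
Proof.
move=> X2; apply: (fps_flow_order X2 (@fps_ord_id i)); by rewrite mdeg0.
Qed.

(** Both operators are continuous and multiplicative and agree on the coordinates by definition.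
    Composing with the map e^X is thus the same as applying the exponential series of the derivation
    X. *)
Lemma fps_subst_exp X f : (forall i, fps_ord 2 (X i)) ->
  fps_subst (fvect_exp X) f = fps_flow X f.
Proof.
move=> X2; have E0 i := @fvect_exp0 X i X2.
apply: (@fps_operator_ext _ _ (fps_subst (fvect_exp X)) (fps_flow X)).
- exact: fps_subst_order.
- exact: fps_flow_order.
- by rewrite /= fps_subst1 // fps_flow1.
- by move=> i; rewrite /= fps_substX.
move=> g h /= e1 e2.
by rewrite (fps_substM E0) (fps_flowM X2 charK) e1 e2.
Qed.

(* If the commutator C = [T, X] raises orders by r, then the part j >= 2 of
   [T, e^X] = \sum_j [T, X^j] / j! raises orders by r + 1; as it equals -C,
   so does C. Hence C raises orders arbitrarily and vanishes. *)
Lemma commute_flow_app T X : order_preserving T -> (forall i, fps_ord 2 (X i)) ->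
  (forall f, T (fps_flow X f) = fps_flow X (T f)) ->
  forall f, T (fvect_app X f) = fvect_app X (T f).
Proof.
move=> oT X2 TX f; apply: fps_eq_ord => e.
have X1 a g : fps_ord a g -> fps_ord a.+1 (fvect_app X g).
  by rewrite -[a.+1]addn1; apply: fps_ord_app.
pose C j g := T (iter j (fvect_app X) g) - iter j (fvect_app X) (T g).
have C1S j g : C j.+1 g = C 1%N (iter j (fvect_app X) g) + fvect_app X (C j g).
  by rewrite /C /= linearB /=; ring.
suff C1r r a g : fps_ord a g -> fps_ord (a + r) (C 1%N g) by apply: (C1r e 0).
elim: r a g => [|r IHr] a g g0.
  rewrite addn0; apply: fps_ordB; first by apply: oT; apply: fps_ord_leq (X1 _ _ g0).
  by apply: fps_ord_leq (leqnSn a) _; apply: X1; apply: oT.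
have Cr j : fps_ord (a + r) (C j g).
  elim: j => [|j IHj]; first by rewrite /C subrr.
  rewrite C1S; apply: fps_ordD.
    by apply: IHr; apply: fps_ord_leq (leq_addr j a) _; apply: fps_ord_iter_app.
  by apply: fps_ord_leq (leqnSn _) _; apply: X1.
have CSSr j : fps_ord (a + r.+1) (C j.+2 g).
  rewrite C1S addnS; apply: fps_ordD; last exact: X1.
  rewrite -addSn; apply: IHr; apply: (@fps_ord_leq _ _ _ (a + j.+1)).
    by rewrite addnS ltnS leq_addr.
  exact: fps_ord_iter_app.
(* Large enough for the remainders to have order a + r + 1, and a visible successor twice over, so
   that the terms j = 0 and j = 1 split off. *)
pose N := (a + r).+3.
have : fps_ord (a + r.+1) (\sum_(j < N) j`!%:R^-1 *: C j g).
  have leN : (a + r.+1 <= N)%N by rewrite /N addnS !ltnS; lia.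
  have := fps_ordB (fps_flow_approx X2 (T g) leN) (oT _ _ (fps_flow_approx X2 g leN)).
  rewrite linearB /= TX (linear_sum T) /=; congr fps_ord.
  set A := fps_flow X (T g); rewrite opprB addrC addrA subrK -sumrB.
  by apply: eq_bigr => j _; rewrite linearZ /= -scalerBr.
rewrite big_ord_recl big_ord_recl {1}/C subrr scaler0 add0r /= factS fact0.
rewrite invr1 scale1r; set S := \sum_(i < _) _ => CS.
rewrite -[C 1%N g](addrK S).
apply: fps_ordB => //; apply: fps_ord_sum => j _; apply: fps_ordZ.
exact: CSSr.
Qed.

Lemma commute_app_flow T X : order_preserving T -> (forall i, fps_ord 2 (X i)) ->
  (forall f, T (fvect_app X f) = fvect_app X (T f)) ->
  forall f, T (fps_flow X f) = fps_flow X (T f).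
Proof.
move=> oT X2 TX f; apply: fps_eq_ord => e.
have TXj j : T (iter j (fvect_app X) f) = iter j (fvect_app X) (T f).
  by elim: j => [|j IHj] //=; rewrite TX IHj.
have := fps_ordB (oT _ _ (fps_flow_approx X2 f (leqnn e)))
                 (fps_flow_approx X2 (T f) (leqnn e)).
rewrite linearB (linear_sum T); congr fps_ord; rewrite /=.
under eq_bigr => j _ do rewrite linearZ /= TXj.
by rewrite opprB addrA subrK.
Qed.

(** The terms j >= 2 of the exponential series. The equation e^X = F becomes the fixed-point problem
    X = F - z - [exp_tail] X. *)
Definition exp_tail X i : fps K n := fun m =>
  \sum_(j < mdeg m) iter j.+2 (fvect_app X) (zvar i) m / (j.+2)`!%:R.

Lemma fvect_expE X i : (forall i, fps_ord 2 (X i)) ->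
  fvect_exp X i = zvar i + X i + exp_tail X i.
Proof.
move=> X2; apply: funext => m; rewrite !fps_addE /exp_tail /fvect_exp.
(* The added term, of index deg m + 1, vanishes at m; it aligns the range with that of
   [exp_tail]. *)
transitivity (\sum_(j < (mdeg m).+2) iter j (fvect_app X) (zvar i) m / j`!%:R).
  rewrite [RHS]big_ord_recr /= (@fps_ord_app _ _ 1 X (mdeg m)) ?mul0r ?addr0 ?addn1 //.
  by apply: (@fps_ord_iter_app _ _ X 0).
rewrite big_ord_recl big_ord_recl fact0 divr1 addrA; congr (_ + _ + _).
by rewrite /= fvect_app_id factS fact0 divr1.
Qed.

(** The contraction behind the fixed point. With u and v the iterates of X and Y, the next
    difference is X (u - v) + (X - Y) v, so every application after the first gains one order, and
    the tail has at least two applications. *)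
Lemma exp_tail_contract X Y e : (forall i, fps_ord 2 (X i)) ->
  (forall i, fps_ord 2 (Y i)) -> (forall i, fps_ord e.+1 (X i - Y i)) ->
  forall i, fps_ord e.+2 (exp_tail X i - exp_tail Y i).
Proof.
move=> X2 Y2 XY i.
have iterXY j : fps_ord (e.+1 + j) (iter j.+1 (fvect_app X) (zvar i)
                                    - iter j.+1 (fvect_app Y) (zvar i)).
  elim: j => [|j IHj]; first by rewrite /= !fvect_app_id addn0.
  set u := iter _ _ _ in IHj *; set v := iter _ _ _ in IHj *.
  have -> : iter j.+2 (fvect_app X) (zvar i) - iter j.+2 (fvect_app Y) (zvar i)
      = fvect_app X (u - v) + fvect_app (fun l => X l - Y l) v.
    by rewrite linearB fvect_appB /=; ring.
  apply: fps_ordD; first by rewrite addnS -addn1; apply: fps_ord_app.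
  rewrite addSnnS addnC; apply: fps_ord_app => //.
  by apply: (@fps_ord_iter_app _ _ Y 1) => //; apply: fps_ord_id.
move=> m lem; rewrite fps_addE fps_oppE -sumrB big1 // => j _.
rewrite -mulrBl; suff -> : iter j.+2 (fvect_app X) (zvar i) m =
  iter j.+2 (fvect_app Y) (zvar i) m by rewrite subrr mul0r.
apply/eqP; rewrite -subr_eq0; apply/eqP; apply: (iterXY j.+1).
by apply: leq_trans lem _; lia.
Qed.

Lemma exp_tail0 i : exp_tail (fun=> 0) i = 0.
Proof.
apply: funext => m; apply: big1 => j _; rewrite /= fvect_appE big1 ?mul0r // => l _.
by rewrite mul0r.
Qed.

Lemma exp_tail_ord X e : (forall i, fps_ord 2 (X i)) ->
  (forall i, fps_ord e.+1 (X i)) -> forall i, fps_ord e.+2 (exp_tail X i).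
Proof.
move=> X2 Xe i; have := @exp_tail_contract X (fun=> 0) e X2 _ _ i.
by rewrite exp_tail0 subr0; apply => // j; rewrite subr0.
Qed.

Lemma fvect_exp_surj F : (forall i, fps_ord 2 (F i - zvar i)) ->
  exists2 X, forall i, fps_ord 2 (X i) & fvect_exp X = F.
Proof.
move=> F2; pose Phi X : fvect K n := fun i => F i - zvar i - exp_tail X i.
pose x k := iter k Phi (fun=> 0).
have Phi2 X : (forall i, fps_ord 2 (X i)) -> forall i, fps_ord 2 (Phi X i).
  move=> X2 i; apply: fps_ordB => //; apply: fps_ord_leq (leqnSn 2) _.
  exact: exp_tail_ord.
have x2 k i : fps_ord 2 (x k i) by elim: k i => [|k IHk] //= i; apply: Phi2.
have PhiB X Y i : Phi X i - Phi Y i = - (exp_tail X i - exp_tail Y i).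
  by rewrite /Phi; ring.
have xS k i : fps_ord k.+1 (x k.+1 i - x k i).
  elim: k i => [|k IHk] i; first by rewrite /= subr0; apply: fps_ord_leq (Phi2 _ _ _).
  rewrite [x k.+2 i]/= [x k.+1 i]/= PhiB; apply: fps_ordN.
  exact: (@exp_tail_contract (x k.+1) (x k)).
have xD k l i : fps_ord k.+1 (x (l + k)%N i - x k i).
  elim: l => [|l IHl]; first by rewrite subrr.
  rewrite addSn -[x (l + k).+1 i](subrK (x (l + k)%N i)) -addrA.
  by apply: fps_ordD => //; apply: fps_ord_leq (xS _ _); rewrite ltnS leq_addl.
(* The limit of the iteration: coefficients of degree d no longer change from the iterate of index d
   on. *)
pose X : fvect K n := fun i m => x (mdeg m) i m.
have Xx k i : fps_ord k.+1 (X i - x k i).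
  move=> m lemk; rewrite fps_addE fps_oppE /X -(subnK (n := k) (m := mdeg m)) //.
  set l := (_ - _)%N.
  have := xD (mdeg m) l i m (leqnn _).
  by rewrite fps_addE fps_oppE => /eqP; rewrite subr_eq0 => /eqP ->; rewrite subrr.
have X2 i : fps_ord 2 (X i).
  by rewrite -[X i](subrK (x 1%N i)); apply: fps_ordD.
exists X => //; apply: funext => i; rewrite fvect_expE //.
suff XPhi : X i = Phi X i by rewrite {1}XPhi /Phi; ring.
apply: fps_eq_ord => e; apply: fps_ord_leq (leqnSn e) _.
apply: fps_ord_leq (leqnSn e.+1) _.
rewrite -[X i](subrK (x e.+1 i)) -addrA; apply: fps_ordD; first exact: Xx.
rewrite [x e.+1 i]/= PhiB; apply: fps_ordN; apply: exp_tail_contract => // j.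
by rewrite -opprB; apply: fps_ordN.
Qed.

(** In X = (e^X - z) - [exp_tail] X the tail has one order more than X, so the order of X climbs to
    that of e^X - z, and their lowest parts agree. *)
Lemma fvect_exp_ord X k : (forall i, fps_ord 2 (X i)) ->
  (forall i, fps_ord k.+1 (fvect_exp X i - zvar i)) ->
  forall i, fps_ord k.+1 (X i) /\ fps_ord k.+2 (fvect_exp X i - zvar i - X i).
Proof.
move=> X2 Fk.
have XE i : X i = (fvect_exp X i - zvar i) - exp_tail X i.
  by rewrite fvect_expE //; ring.
have Xe e : (e <= k)%N -> forall i, fps_ord e.+1 (X i).
  elim: e => [|e IHe] leek i; first exact: fps_ord_leq (X2 i).
  rewrite XE; apply: fps_ordB; first exact: fps_ord_leq (Fk i).
  by apply: exp_tail_ord => //; apply: IHe; apply: ltnW.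
move=> i; split; first exact: Xe.
have -> : fvect_exp X i - zvar i - X i = exp_tail X i by rewrite fvect_expE //; ring.
by apply: exp_tail_ord => //; apply: Xe.
Qed.

End ExpLog.

(** * Homogeneous parts *)

Section Homogeneous.
Variables (K : fieldType) (n : nat).
Implicit Types (f g : fps K n) (p q : {mpoly K[n]}) (i j : 'I_n).
Implicit Types (X Y : fvect K n).

Lemma mcoeff_hpart e f m : (fps_hpart e f)@_m = if mdeg m == e then f m else 0.
Proof.
rewrite raddf_sum /=; under eq_bigr => k _ do rewrite mcoeffZ mcoeffX.
case: eqP => [me|me]; last first.
  apply: big1 => k /eqP ke; case: eqP => [km|]; last by rewrite mulr0.
  by case: me; rewrite -km.
have lem : (mdeg m < e.+1)%N by rewrite me.
rewrite (bigD1 (Sub m lem)) /= ?me // eqxx mulr1 big1 ?addr0 // => k /andP[_ km].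
rewrite (_ : val k == m = false) ?mulr0 //.
by apply: contra_neqF km => /eqP km; apply: val_inj.
Qed.

Fact fps_hpart_is_linear e : linear (@fps_hpart K n e).
Proof.
move=> c f g; apply/mpolyP => m; rewrite mcoeffD mcoeffZ !mcoeff_hpart.
by case: ifP => _; rewrite ?mulr0 ?addr0.
Qed.
HB.instance Definition _ e := GRing.isLinear.Build K (fps K n) {mpoly K[n]} _
  (@fps_hpart K n e) (fps_hpart_is_linear e).

Lemma hpart_homog e f : fps_hpart e f \is e.-homog.
Proof.
apply/dhomogP => m; rewrite mcoeff_msupp mcoeff_hpart.
by case: (mdeg m =P e) => //; rewrite eqxx.
Qed.

Lemma hpart_ord d e f : fps_ord d f -> (e < d)%N -> fps_hpart e f = 0.
Proof.
move=> f0 ltd; apply/mpolyP => m; rewrite mcoeff_hpart mcoeff0.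
by case: eqP => // me; rewrite f0 ?me.
Qed.

Lemma ord_hpart e f : fps_ord e f -> fps_hpart e f = 0 -> fps_ord e.+1 f.
Proof.
move=> f0 h0 m; rewrite ltnS leq_eqVlt => /orP[/eqP me|]; last exact: f0.
by have := mcoeff_hpart e f m; rewrite h0 me eqxx mcoeff0.
Qed.

Lemma hpartM e f g :
  fps_hpart e (f * g) = \sum_(a < e.+1) fps_hpart a f * fps_hpart (e - a) g.
Proof.
apply/mpolyP => m; rewrite mcoeff_hpart raddf_sum /=.
under [RHS]eq_bigr => a _ do rewrite mcoeffM.
rewrite exchange_big /=.
have termE (u v : 'X_{1..n}) : m = (u + v)%MM ->
    \sum_(a < e.+1) (fps_hpart a f)@_u * (fps_hpart (e - a) g)@_v =
    if mdeg m == e then f u * g v else 0.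
  move=> mE; have dE : mdeg m = (mdeg u + mdeg v)%N by rewrite mE mdegD.
  case: eqP => me; last first.
    apply: big1 => a _; rewrite !mcoeff_hpart.
    case: eqP => ua; last by rewrite mul0r.
    case: eqP => va; last by rewrite mulr0.
    by case: me; rewrite dE ua va subnKC // -ltnS.
  have ue : (mdeg u < e.+1)%N by rewrite ltnS -me dE leq_addr.
  rewrite (bigD1 (Ordinal ue)) //= big1 ?addr0 => [|a ua].
    by rewrite !mcoeff_hpart eqxx -me dE addKn eqxx.
  rewrite mcoeff_hpart; case: eqP => [uE|]; last by rewrite mul0r.
  by case/eqP: ua; apply: val_inj; rewrite /= uE.
under [RHS]eq_bigr => k /eqP mE do rewrite (termE _ _ mE).
by case: ifP => // _; rewrite big1.
Qed.

Lemma hpartM_ord a b f g : fps_ord a f -> fps_ord b g ->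
  fps_hpart (a + b) (f * g) = fps_hpart a f * fps_hpart b g.
Proof.
move=> f0 g0; rewrite hpartM.
have lta : (a < (a + b).+1)%N by rewrite ltnS leq_addr.
rewrite (bigD1 (Ordinal lta)) //= addKn big1 ?addr0 // => i ia.
have [ltia|leai] := ltnP i a; first by rewrite (hpart_ord f0) ?mul0r.
rewrite (hpart_ord g0) ?mulr0 //.
have /eqP ia' : (i : nat) != a by apply: contra_neq ia => E; apply: val_inj.
have := ltn_ord i; lia.
Qed.

Lemma hpartM_ordS a b f g : fps_ord a f -> fps_ord b g ->
  fps_hpart (a + b).+1 (f * g) =
  fps_hpart a f * fps_hpart b.+1 g + fps_hpart a.+1 f * fps_hpart b g.
Proof.
move=> f0 g0; rewrite hpartM.
have lta : (a < (a + b).+2)%N by lia.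
have ltSa : (a.+1 < (a + b).+2)%N by lia.
rewrite (bigD1 (Ordinal lta)) //= (bigD1 (Ordinal ltSa)) /=; last first.
  by apply/eqP => /(congr1 val) /= /eqP; rewrite eqn_leq ltnn.
have -> : ((a + b).+1 - a = b.+1)%N by lia.
have -> : ((a + b).+1 - a.+1 = b)%N by lia.
rewrite big1 ?addr0 // => i /andP[ia iSa].
have [ltia|leai] := ltnP i a; first by rewrite (hpart_ord f0) ?mul0r.
rewrite (hpart_ord g0) ?mulr0 //.
have /eqP ia' : (i : nat) != a by apply: contra_neq ia => E; apply: val_inj.
have /eqP iSa' : (i : nat) != a.+1 by apply: contra_neq iSa => E; apply: val_inj.
have := ltn_ord i; lia.
Qed.

Lemma hpart_diff e i f : fps_hpart e (fps_diff i f) = (fps_hpart e.+1 f)^`M(i).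
Proof.
apply/mpolyP => m; rewrite mcoeff_hpart mcoeff_deriv mcoeff_hpart mdegD mdeg1.
by rewrite addn1 eqSS; case: eqP; rewrite ?mul0rn.
Qed.

Lemma hpart_app r s X f : (forall i, fps_ord r (X i)) -> fps_ord s.+1 f ->
  fps_hpart (r + s) (fvect_app X f) =
  \sum_j fps_hpart r (X j) * (fps_hpart s.+1 f)^`M(j).
Proof.
move=> X0 f0; rewrite fvect_appE linear_sum; apply: eq_bigr => j _ /=.
by rewrite hpartM_ord ?hpart_diff //; apply: fps_ord_diff.
Qed.

Lemma hpart_appS r s X f : (forall i, fps_ord r (X i)) -> fps_ord s.+1 f ->
  fps_hpart (r + s).+1 (fvect_app X f) =
  \sum_j (fps_hpart r (X j) * (fps_hpart s.+2 f)^`M(j)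
          + fps_hpart r.+1 (X j) * (fps_hpart s.+1 f)^`M(j)).
Proof.
move=> X0 f0; rewrite fvect_appE linear_sum; apply: eq_bigr => j _ /=.
by rewrite hpartM_ordS ?hpart_diff //; apply: fps_ord_diff.
Qed.

Lemma euler_homog e p : p \is e.-homog ->
  \sum_j 'X_j * p^`M(j) = e%:R *: p.
Proof.
move=> /dhomogP hp; rewrite {2}(mpolyE p) scaler_sumr.
under eq_bigr => j _ do rewrite {1}(mpolyE p) linear_sum mulr_sumr.
rewrite exchange_big /= big_seq [RHS]big_seq; apply: eq_bigr => m pm.
rewrite -(hp m pm) /= mdegE natr_sum scaler_suml; apply: eq_bigr => j _.
rewrite mderivZ mderivX -scalerAr; have [->|mj] := eqVneq (m j) 0%N.
  by rewrite !scale0r mulr0 scaler0.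
rewrite -scalerAr -mpolyXD addmC submK ?lep1mP //.
by rewrite !scalerA mulrC.
Qed.

Lemma mpoly_divX i p : (forall m : 'X_{1..n}, m i = 0%N -> p@_m = 0) ->
  exists q, p = q * 'X_i.
Proof.
move=> p0; exists (\sum_(m <- msupp p) p@_m *: 'X_[m - U_(i)]).
rewrite {1}(mpolyE p) mulr_suml big_seq [RHS]big_seq; apply: eq_bigr => m.
rewrite mcoeff_msupp => pm; rewrite -scalerAl -mpolyXD submK // lep1mP.
by apply: contraNneq pm => /p0 ->.
Qed.

Lemma mcoeff_mulX_eq0 i p (m : 'X_{1..n}) : m i = 0%N -> ('X_i * p)@_m = 0.
Proof.
move=> mi; rewrite (mpolyE p) mulr_sumr raddf_sum big1 //= => m' _.
rewrite -scalerAr -mpolyXD mcoeffZ mcoeffX; case: eqP => [e|]; last by rewrite mulr0.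
by move: mi; rewrite -e mnmDE mnm1E eqxx.
Qed.

Lemma homog_msize k p : p \is k.-homog -> p != 0 -> msize p = k.+1.
Proof. by move=> /dhomogP hp p0; rewrite -mlead_deg // hp ?mlead_supp. Qed.

End Homogeneous.

(** * The centralizer of a regular dicritic vector field *)

Section Centralizer.
Variables (K : fieldType) (n : nat).
Hypothesis charK : [pchar K] =i pred0.
Implicit Types (f g p q : {mpoly K[n]}) (i j : 'I_n).
Implicit Types (X Y : fvect K n).

Lemma mpoly_natr_neq0 k : k.+1%:R != 0 :> {mpoly K[n]}.
Proof. by rewrite -mpolyC_nat mpolyC_eq0 natr_pchar0_neq0. Qed.

Lemma mpoly_natr_inj k l : k%:R = l%:R :> {mpoly K[n]} -> k = l.
Proof.
wlog lekl : k l / (k <= l)%N.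
  by move=> W e; case/orP: (leq_total k l) => ?; [apply: W|symmetry; apply: W].
move=> e; apply/eqP; rewrite eqn_leq lekl -subn_eq0 /=.
have := mpoly_natr_neq0 (l - k).-1; case: (l - k)%N (natrB {mpoly K[n]} lekl) => //= d.
by rewrite e subrr => ->; rewrite eqxx.
Qed.

Lemma radial_app e f p : p \is e.-homog ->
  \sum_j f * 'X_j * p^`M(j) = e%:R * f * p.
Proof.
move=> hp; under eq_bigr => j _ do rewrite -mulrA.
by rewrite -mulr_sumr (euler_homog hp) scaler_nat -mulr_natl; ring.
Qed.

(** The derivation C applied to the components of f R gives C(f) R + f C, because C(z_i) = C_i. *)
Lemma app_radial (C : 'I_n -> {mpoly K[n]}) f i :
  \sum_j C j * (f * 'X_i)^`M(j) = 'X_i * (\sum_j C j * f^`M(j)) + f * C i.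
Proof.
rewrite mulr_sumr (bigD1 i) //= [in RHS](bigD1 i) //=.
rewrite (eq_bigr (fun j => 'X_i * (C j * f^`M(j)))) => [|j ji].
  by rewrite mderivM mderivXU eqxx /=; ring.
by rewrite mderivM mderivXU (negbTE ji) mulr0 addr0; ring.
Qed.

Section Dicritic.
Variables (k : nat) (X : fvect K n) (f : {mpoly K[n]}).
Hypothesis Xk : forall i, fps_ord k.+1 (X i).
Hypothesis Xf : forall i, fps_hpart k.+1 (X i) = f * 'X_i.
Hypotheses (f_homog : f \is k.-homog) (f0 : f != 0).

(** If C is the part of Y of degree l + 1, the lowest part of the bracket is [f R, C] = l f C - C(f)
    R. Its vanishing makes C proportional to R; for C = g R, Euler's identity turns it into (l - k)
    f g R = 0. *)
Lemma dicritic_centralizer_leading l Y i0 j0 : i0 != j0 -> (0 < l)%N ->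
  (forall i, fps_ord l.+1 (Y i)) ->
  (forall i, fvect_app X (Y i) = fvect_app Y (X i)) ->
  exists2 g, forall i, fps_hpart l.+1 (Y i) = g * 'X_i & g != 0 -> l = k.
Proof.
move=> ij0 l0 Yl XY; pose C i := fps_hpart l.+1 (Y i).
pose Cf := \sum_j C j * f^`M(j).
have eqC i : l%:R * f * C i = 'X_i * Cf.
  have := congr1 (fps_hpart (k.+1 + l)) (XY i).
  rewrite hpart_app // addSnnS addnC hpart_app //.
  under eq_bigr => j _ do rewrite Xf.
  rewrite (radial_app _ (hpart_homog _ _)) Xf app_radial -/(C i) -/Cf => e.
  by apply: (addIr (f * C i)); rewrite -e -natr1; ring.
have lf0 : l%:R * f != 0.
  by rewrite mulf_neq0 // -(prednK l0) mpoly_natr_neq0.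
have crossC i j : 'X_j * C i = 'X_i * C j.
  apply: (mulfI lf0); rewrite mulrCA eqC [RHS]mulrCA eqC; ring.
have X0 i : 'X_i != 0 :> {mpoly K[n]} by rewrite -msize_poly_eq0 msizeX.
have [g gE] : exists g, C i0 = g * 'X_i0.
  (* Since i0 and j0 differ, multiplying by z_j0 keeps the exponent of z_i0 equal to 0, whereas z_j0
     C_i0 = z_i0 C_j0 is a multiple of z_i0. *)
  apply: mpoly_divX => m mi0; transitivity (('X_j0 * C i0)@_(m + U_(j0))).
    by rewrite mulrC addmC mcoeffMX.
  by rewrite crossC mcoeff_mulX_eq0 // mnmDE mi0 mnm1E eq_sym (negbTE ij0).
have Cg i : C i = g * 'X_i.
  by apply: (mulfI (X0 i0)); rewrite crossC gE; ring.
exists g => // g0; apply: mpoly_natr_inj.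
apply: (mulIf (mulf_neq0 (mulf_neq0 f0 g0) (X0 i0))).
transitivity (l%:R * f * C i0); first by rewrite gE; ring.
rewrite eqC /Cf; under eq_bigr => j _ do rewrite Cg.
by rewrite (radial_app _ f_homog); ring.
Qed.

(** With P and D the parts of degree k + 2 of X and Y, the bracket in degree 2k + 2 says that (k +
    1) (f D - g P) is a multiple of R; the cross products with z_i and z_j eliminate the multiplier
    [Q]. *)
Lemma dicritic_centralizer_next Y g :
  (forall i, fps_ord k.+1 (Y i)) -> (forall i, fps_hpart k.+1 (Y i) = g * 'X_i) ->
  (forall i, fvect_app X (Y i) = fvect_app Y (X i)) -> forall i j,
  f * ('X_j * fps_hpart k.+2 (Y i) - 'X_i * fps_hpart k.+2 (Y j)) =
  g * ('X_j * fps_hpart k.+2 (X i) - 'X_i * fps_hpart k.+2 (X j)).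
Proof.
move=> Yk Yg XY.
pose P i := fps_hpart k.+2 (X i); pose D i := fps_hpart k.+2 (Y i).
pose Q := \sum_j D j * f^`M(j) - \sum_j P j * g^`M(j).
have eqD i : k.+1%:R * (f * D i - g * P i) = 'X_i * Q.
  have := congr1 (fps_hpart (k.+1 + k).+1) (XY i).
  rewrite !hpart_appS // !big_split /=.
  under eq_bigr => j _ do rewrite Xf.
  under [X in _ + X = _]eq_bigr => j _ do rewrite Yg.
  under [X in _ = X + _]eq_bigr => j _ do rewrite Yg.
  under [X in _ = _ + X]eq_bigr => j _ do rewrite Xf.
  rewrite !(radial_app _ (hpart_homog _ _)) !app_radial /Q.
  set SD := \sum_j D j * _; set SP := \sum_j P j * _.
  rewrite -/(P i) -/(D i) -!(natr1 k.+1) => e.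
  apply: (addIr ('X_i * SP + f * D i + g * P i + k.+1%:R * g * P i)).
  transitivity ((k.+1%:R + 1) * f * D i + ('X_i * SP + g * P i)); first by ring.
  by rewrite e; ring.
move=> i j; apply: (mulfI (mpoly_natr_neq0 k)).
transitivity (k.+1%:R * g * ('X_j * P i - 'X_i * P j)
  + 'X_j * (k.+1%:R * (f * D i - g * P i)) - 'X_i * (k.+1%:R * (f * D j - g * P j))).
  by rewrite -/(P i) -/(P j) -/(D i) -/(D j); ring.
by rewrite !eqD -/(P i) -/(P j); ring.
Qed.

End Dicritic.

Lemma fvect_leading Y : (forall i, fps_ord 2 (Y i)) -> (exists i, Y i != 0) ->
  exists l i, [/\ (0 < l)%N, forall j, fps_ord l.+1 (Y j)
                & fps_hpart l.+1 (Y i) != 0].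
Proof.
move=> Y2 [i Yi]; have /existsNP[m /eqP Ym] : ~ forall m, Y i m = 0.
  by move=> Y0; case/eqP: Yi; apply: funext.
pose P e := `[< exists j m, mdeg m = e /\ Y j m != 0 >].
have exP : exists e, P e by exists (mdeg m); apply/asboolP; exists i, m.
case: (ex_minnP exP) => e /asboolP[j [m' [me Yj]]] mine.
have Ye j' : fps_ord e (Y j').
  move=> m1 ltm1; apply/eqP; apply: contraTT ltm1 => Y1.
  by rewrite -leqNgt; apply: mine; apply/asboolP; exists j', m1.
have gte1 : (1 < e)%N.
  by rewrite ltnNge; apply: contra Yj => lee; rewrite (Y2 j) // me.
exists e.-1, j; rewrite prednK ?(ltnW gte1) //; split => //.
  by rewrite -subn1 subn_gt0.
apply: contra Yj => /eqP /(congr1 (mcoeff m')).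
by rewrite mcoeff_hpart me eqxx mcoeff0 => ->.
Qed.

Proposition regular_dicritic_centralizer k X Y : (0 < k)%N -> regular_dicritic k X ->
  (forall i, fps_ord 2 (Y i)) ->
  (forall i, fvect_app X (Y i) = fvect_app Y (X i)) ->
  exists c, forall i, Y i = c *: X i.
Proof.
move=> k0 [f [[Xk [i1 Xi1]] f_homog Xf] [i0 [j0 cop]]] Y2 XY.
have f0 : f != 0 by apply: contraNneq Xi1 => f0; rewrite Xf f0 mul0r.
(* For i0 = j0 the second polynomial would be 0, so f would be a unit, hence constant, although its
   degree k is positive. *)
have ij0 : i0 != j0.
  apply/eqP => ij; have fu : f \is a GRing.unit.
    by apply: cop; [exists 1; rewrite mul1r | exists 0; rewrite ij subrr mul0r].
  have fE := mpoly_unit_constant fu.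
  have /eqP : msize f == 1%N.
    apply/msize_poly1P; exists f@_0%MM => //.
    by apply: contraNneq f0 => c0; rewrite fE c0 mpolyC0.
  by rewrite (homog_msize f_homog f0); case: (k) k0.
have [Y0|/existsNP[i /eqP Yi]] := pselect (forall i, Y i = 0).
  by exists 0 => i; rewrite Y0 scale0r.
have [l [i2 [l0 Yl Yi2]]] := fvect_leading Y2 (ex_intro _ i Yi).
have [g Yg lk] := dicritic_centralizer_leading Xk Xf f_homog f0 ij0 l0 Yl XY.
have g0 : g != 0 by apply: contraNneq Yi2 => g0; rewrite Yg g0 mul0r.
have {l0 lk} lk := lk g0; subst l.
have [q gE] : divides f g.
  apply: (factorial_coprime_divides (@factorial_mpoly K n)) cop _.
  eexists; rewrite -(dicritic_centralizer_next Xk Xf Yl Yg XY i0 j0) mulrC.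
  reflexivity.
have g_homog : g \is k.-homog.
  apply/dhomogP => m; rewrite mcoeff_msupp; apply: contraNeq => mk.
  have := mcoeff_hpart k.+1 (Y i0) (U_(i0) + m)%MM.
  by rewrite Yg mcoeffMX mdegD mdeg1 add1n eqSS (negbTE mk) => ->.
(* f and g = q f are both nonzero of degree k, which leaves degree 0 for q. *)
have qC : q = (q@_0%MM)%:MP.
  apply: msize1_polyC.
  have q0 : q != 0 by apply: contraNneq g0 => q0; rewrite gE q0 mul0r.
  have := msizeM q0 f0; rewrite -gE (homog_msize g_homog g0) (homog_msize f_homog f0).
  by lia.
set c := q@_0%MM in qC; exists c.
pose Z : fvect K n := fun i => Y i - c *: X i.
suff Z0 i' : Z i' = 0 by move=> i''; apply/eqP; rewrite -subr_eq0; apply/eqP/Z0.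
have Zk j : fps_ord k.+2 (Z j).
  apply: ord_hpart; first by apply: fps_ordB (Yl j) _; apply: fps_ordZ; apply: Xk.
  by rewrite /Z linearB linearZ /= Yg Xf gE qC mul_mpolyC scalerAl subrr.
have XZ j : fvect_app X (Z j) = fvect_app Z (X j).
  by rewrite fvect_appB fvect_appZ linearB linearZ /= XY.
apply/eqP; apply: contraT => Zi'.
have Z2 j : fps_ord 2 (Z j) by apply: fps_ord_leq (Zk j).
have [l [i3 [l0 Zl Zi3]]] := fvect_leading Z2 (ex_intro _ i' Zi').
have [g' Zg lk] := dicritic_centralizer_leading Xk Xf f_homog f0 ij0 l0 Zl XZ.
have lk' : l = k by apply: lk; apply: contraNneq Zi3 => g'0; rewrite Zg g'0 mul0r.
by case/eqP: Zi3; apply: (hpart_ord (Zk i3)); rewrite lk'.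
Qed.

End Centralizer.

(** * Groups of formal diffeomorphisms *)

Section Groups.
Variables (K : fieldType) (n : nat).
Implicit Types (f g : fps K n) (i j : 'I_n) (F H : fmap K n) (A B : 'M[K]_n).
Implicit Types (X Y : fvect K n).

Notation zvar := (@fmap_id K n).

Lemma fps_ord_linear_part f : f 0%MM = 0 ->
  fps_ord 2 (f - \sum_j f U_(j)%MM *: zvar j).
Proof.
move=> f0 m; rewrite ltnS leq_eqVlt => /orP[/mdeg1P[j /eqP ->]|].
  rewrite fps_addE fps_oppE fps_sumE (bigD1 j) //= fps_scaleE.
  rewrite /fmap_id /fps_of_mpoly mcoeffXU eqxx mulr1 big1 ?addr0 ?subrr // => l lj.
  by rewrite fps_scaleE mcoeffXU (negbTE lj) mulr0.
move=> m0; apply: (@fps_ordB _ _ 1) => //; first exact: fps_ord1.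
by apply: fps_ord_sum => j _; apply: fps_ordZ; apply: fps_ord_id.
Qed.

(** Substituting H preserves order 2, so only the linear part of F contributes to the derivative at
    0. *)
Lemma jac0_comp F H : (forall i, F i 0%MM = 0) -> (forall i, H i 0%MM = 0) ->
  jac0 (fmap_comp F H) = jac0 F *m jac0 H.
Proof.
move=> F0 H0; apply/matrixP => i j; rewrite !mxE.
have := fps_subst_order H0 (fps_ord_linear_part (F0 i)).
rewrite linearB (linear_sum (fps_subst H)) /= => /(_ U_(j)%MM).
rewrite mdeg1 => /(_ isT); rewrite fps_addE fps_oppE => /eqP.
rewrite subr_eq0 -[fmap_comp F H i]/(fps_subst H (F i)) => /eqP ->.
rewrite fps_sumE; apply: eq_bigr => l _.
by rewrite linearZ /= fps_scaleE fps_substX // !mxE.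
Qed.

Lemma jac0_id : jac0 zvar = 1%:M.
Proof.
apply/matrixP => i j; rewrite !mxE /fmap_id /fps_of_mpoly mcoeffXU.
by case: eqP.
Qed.

Lemma fps_ord_jac0_1 F i : (forall i, F i 0%MM = 0) -> jac0 F = 1%:M ->
  fps_ord 2 (F i - zvar i).
Proof.
move=> F0 JF; have := fps_ord_linear_part (F0 i).
rewrite (bigD1 i) //= big1 ?addr0 => [|j ji].
  by have := congr1 (fun A : 'M_n => A i i) JF; rewrite !mxE eqxx => ->; rewrite scale1r.
have := congr1 (fun A : 'M_n => A i j) JF; rewrite !mxE eq_sym (negbTE ji) => ->.
by rewrite scale0r.
Qed.

Lemma fmap_linE A i : fmap_lin A i = \sum_j A i j *: zvar j.
Proof. by rewrite /fmap_lin linear_sum; apply: eq_bigr => j _; rewrite linearZ. Qed.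

Lemma fmap_lin0 A i : fmap_lin A i 0%MM = 0.
Proof.
rewrite fmap_linE fps_sumE big1 // => j _.
by rewrite fps_scaleE (@fps_ord_id _ _ j) ?mdeg0 ?mulr0.
Qed.

Lemma jac0_lin A : jac0 (fmap_lin A) = A.
Proof.
apply/matrixP => i j; rewrite mxE fmap_linE fps_sumE (bigD1 j) //= big1 ?addr0.
  by rewrite fps_scaleE /fmap_id /fps_of_mpoly mcoeffXU eqxx mulr1.
move=> l lj.
by rewrite fps_scaleE /fmap_id /fps_of_mpoly mcoeffXU (negbTE lj) mulr0.
Qed.

Lemma fmap_comp_lin A B :
  fmap_comp (fmap_lin A) (fmap_lin B) = fmap_lin (A *m B).
Proof.
apply: funext => i; rewrite -[LHS]/(fps_subst (fmap_lin B) (fmap_lin A i)).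
rewrite !fmap_linE (linear_sum (fps_subst (fmap_lin B))).
transitivity (\sum_j \sum_l (A i j * B j l) *: zvar l).
  apply: eq_bigr => j _; rewrite linearZ /= fps_substX; last exact: fmap_lin0.
  by rewrite fmap_linE scaler_sumr; apply: eq_bigr => l _; rewrite scalerA.
rewrite exchange_big /=; apply: eq_bigr => l _.
by rewrite mxE scaler_suml.
Qed.

Lemma fvect_app_order X : (forall i, fps_ord 1 (X i)) ->
  order_preserving (fvect_app X).
Proof. by move=> X1 e f f0; rewrite -[e]addn0; apply: fps_ord_app. Qed.

(** Composing with F turns F_* X = X into X(F_i) = X_i o F, which is commutation on the coordinates.
    Both composites obey the same Leibniz rule twisted by F, so commutation extends to all
    series. *)
Lemma pushforward_fixedP F H X : (forall i, fps_ord 1 (X i)) ->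
  (forall i, F i 0%MM = 0) -> is_inverse F H ->
  pushforward F X = X <->
  forall f, fvect_app X (fps_subst F f) = fps_subst F (fvect_app X f).
Proof.
move=> X1 F0 invH.
have [[H'0 _] FH HF] : is_inverse F (fmap_inv F).
  by apply: epsilon_spec; exists H.
split=> [pX|XF]; last first.
  apply: funext => i; rewrite /pushforward -(fps_substX F0) XF fvect_app_id.
  by rewrite -/(fps_subst _ _) -fps_subst_comp // FH fps_subst_id.
have XFi i : fvect_app X (F i) = fps_subst F (X i).
  rewrite -{2}pX /pushforward -/(fps_subst (fmap_inv F) _).
  by rewrite -fps_subst_comp // HF fps_subst_id.
have oX := fvect_app_order X1; have oF := fps_subst_order F0.
apply: (@fps_operator_ext _ _ (fvect_app X \o fps_subst F)
                              (fps_subst F \o fvect_app X)) => /=.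
- by move=> e f f0; apply/oX/oF.
- by move=> e f f0; apply/oF/oX.
- by rewrite fps_subst1 // fvect_app1 linear0.
- by move=> i; rewrite fps_substX // fvect_app_id.
move=> f g e1 e2.
by rewrite fps_substM // !fvect_appM linearD /= !fps_substM // e1 e2.
Qed.

(** The choice in [fmap_log] requires a preimage of exact order. Its part of degree k + 1 is that of
    F - z, and z has none because k > 0, so it is nonzero. *)
Lemma fmap_log_spec k F : (0 < k)%N -> is_tangent_id k F ->
  (forall i, fps_ord 2 (fmap_log F i)) /\ fvect_exp (fmap_log F) = F.
Proof.
move=> k0 [Fk [i Fi]].
have Fz j : fps_ord k.+1 (F j - zvar j).
  by move=> m lem; rewrite fps_addE fps_oppE Fk ?subrr.
have [X X2 XF] : exists2 X, forall i, fps_ord 2 (X i) & fvect_exp X = F.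
  by apply: fvect_exp_surj => j; apply: fps_ord_leq (Fz j).
have [[k' k'0 [Yk' _]] YF] : (exists2 k', (1 <= k')%N & vanishes_to k' (fmap_log F))
    /\ fvect_exp (fmap_log F) = F.
  apply: (epsilon_spec (inhabits ((fun _ _ => 0) : fvect K n)) (fun X =>
    (exists2 k, (1 <= k)%N & vanishes_to k X) /\ fvect_exp X = F)).
  exists X; split=> //; exists k => //.
  have Xk := fvect_exp_ord X2; rewrite XF in Xk.
  split=> [j|]; first by have [] := Xk k Fz j.
  exists i; apply: contraNneq Fi => Xi; have [_ XFi] := Xk k Fz i.
  have := hpart_ord XFi (ltnSn _); rewrite !linearB /= Xi subr0.
  have -> : fps_hpart k.+1 (zvar i) = 0.
    apply/mpolyP => m; rewrite mcoeff_hpart mcoeff0 /fmap_id /fps_of_mpoly mcoeffX.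
    case: eqP => // mk; case: eqP => // im; move: mk; rewrite -im mdeg1.
    by move=> [kE]; rewrite -kE in k0.
  by rewrite subr0 => /eqP.
split=> // j m lem; apply: Yk'; exact: leq_trans (ltnSE lem) k'0.
Qed.

Proposition regular_dicritic_abelian_iff (G : fmap K n -> Prop) F :
  [pchar K] =i pred0 ->
  is_fdiffeo_subgroup G ->
  G F -> regular_dicritic_fdiffeo F ->
  (forall A, derivative_group G A -> G (fmap_lin A)) ->
  (abelian_fdiffeo G <->
   abelian_mx (derivative_group G) /\ invariant_by G (fmap_log F)).
Proof.
move=> charK subG GF [k [k0 Fk Xreg]] GD; set X := fmap_log F in Xreg *.
have [X2 XF] := fmap_log_spec k0 Fk; rewrite -/X in X2 XF.
have X1 i : fps_ord 1 (X i) by apply: fps_ord_leq (X2 i).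
have G0 H : G H -> forall i, H i 0%MM = 0.
  by move=> GH; have [] := subgroup_fdiffeo subG GH.
have invariantP H : G H -> pushforward H X = X <->
    forall f, fvect_app X (fps_subst H f) = fps_subst H (fvect_app X f).
  move=> GH; have [H' _ HH'] := subgroup_inv subG GH.
  by apply: pushforward_fixedP HH' => //; apply: G0.
split=> [abG|[abD invX]].
  split=> [_ _ [H1 G1 ->] [H2 G2 ->]|H GH].
    by rewrite -(jac0_comp (G0 _ G1) (G0 _ G2)) abG // (jac0_comp (G0 _ G2) (G0 _ G1)).
  apply/(invariantP H GH) => f; symmetry; move: f.
  (* The pullback by F is the flow of X, and H commutes with F. *)
  apply: (@commute_flow_app _ _ (fps_subst H)) => //.
    exact/fps_subst_order/G0.
  move=> f; rewrite /= -!(fps_subst_exp charK _ X2) XF.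
  rewrite -(fps_subst_comp f (G0 _ GF) (G0 _ GH)) abG //.
  by rewrite (fps_subst_comp f (G0 _ GH) (G0 _ GF)).
pose cX (c : K) : fvect K n := fun i => c *: X i.
have cX2 c i : fps_ord 2 (cX c i) by apply: fps_ordZ.
have decomp H : G H -> exists A c, derivative_group G A /\
    forall f, fps_subst H f = fps_flow (cX c) (fps_subst (fmap_lin A) f).
  move=> GH; have DA : derivative_group G (jac0 H) by exists H.
  set A := jac0 H in DA; have GA := GD A DA.
  have [L GL [_ AL LA]] := subgroup_inv subG GA.
  (* P = A^-1 o H is tangent to the identity and lies in G. *)
  have GK := subgroup_comp subG GL GH; set P := fmap_comp L H in GK.
  have P2 i : fps_ord 2 (P i - fmap_id _ i).
    apply: fps_ord_jac0_1; first exact: G0.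
    rewrite /P (jac0_comp (G0 _ GL) (G0 _ GH)) -/A -(jac0_lin A).
    by rewrite -(jac0_comp (G0 _ GL) (G0 _ GA)) LA jac0_id.
  have [Y Y2 YP] := fvect_exp_surj P2.
  have XY f : fvect_app X (fvect_app Y f) = fvect_app Y (fvect_app X f).
    (* Here X plays the role of the operator T: invariance by P makes X commute with e^Y, hence with
       Y. *)
    apply: commute_flow_app => //; first exact: fvect_app_order.
    move=> g; rewrite /= -!(fps_subst_exp charK _ Y2) YP.
    apply: (iffLR (invariantP P GK)).
    exact: invX.
  have [|c Yc] := regular_dicritic_centralizer charK k0 Xreg Y2.
    by move=> i; rewrite -(fvect_app_id Y) XY fvect_app_id.
  exists A, c; split=> // f.
  have {Yc} <- : Y = cX c by apply: funext.
  rewrite -(fps_subst_exp charK _ Y2) YP (fps_subst_comp _ (G0 _ GL) (G0 _ GH)).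
  by rewrite -(fps_subst_comp f (G0 _ GA) (G0 _ GL)) AL fps_subst_id.
move=> H1 H2 G1 G2.
have [G12 G21] := (subgroup_comp subG G1 G2, subgroup_comp subG G2 G1).
apply: (fmap_eq_subst (G0 _ G12) (G0 _ G21)).
move=> f; rewrite (fps_subst_comp f (G0 _ G1) (G0 _ G2)).
rewrite (fps_subst_comp f (G0 _ G2) (G0 _ G1)).
have [A1 [c1 [D1 H1E]]] := decomp H1 G1; have [A2 [c2 [D2 H2E]]] := decomp H2 G2.
have A_flow A c g : derivative_group G A ->
    fps_subst (fmap_lin A) (fps_flow (cX c) g)
    = fps_flow (cX c) (fps_subst (fmap_lin A) g).
  move=> DA; apply: (@commute_app_flow _ _ (fps_subst (fmap_lin A))) => //.
    exact/fps_subst_order/fmap_lin0.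
  move=> h; rewrite !fvect_appZ linearZ /=; congr (_ *: _); symmetry.
  by apply: (iffLR (invariantP _ _)); [apply: GD|apply/invX/GD].
have X_flow c g : fvect_app X (fps_flow (cX c) g) = fps_flow (cX c) (fvect_app X g).
  apply: (@commute_app_flow _ _ (fvect_app X)) => //; first exact: fvect_app_order.
  by move=> h; rewrite !fvect_appZ linearZ.
have flow_flow g : fps_flow (cX c1) (fps_flow (cX c2) g)
    = fps_flow (cX c2) (fps_flow (cX c1) g).
  apply: (@commute_app_flow _ _ (fps_flow (cX c1))) => //.
    exact: fps_flow_order.
  by move=> h; rewrite !fvect_appZ linearZ /= X_flow.
(* With the linear substitutions moved inside and the flows exchanged, only the commutation of A1
   and A2 remains. *)
rewrite !H1E !H2E (A_flow _ _ _ D1) (A_flow _ _ _ D2) flow_flow.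
congr (fps_flow _ (fps_flow _ _)).
rewrite -(fps_subst_comp f (fmap_lin0 A1) (fmap_lin0 A2)).
by rewrite -(fps_subst_comp f (fmap_lin0 A2) (fmap_lin0 A1)) !fmap_comp_lin abD.
Qed.

End Groups.

Theorem proposition1p20 (R : realType) (n : nat)
    (G : fmap R[i]%C n -> Prop) (F : fmap R[i]%C n) :
  is_fdiffeo_subgroup G ->
  G F -> regular_dicritic_fdiffeo F ->
  (forall A, derivative_group G A -> G (fmap_lin A)) ->
  (abelian_fdiffeo G <->
   abelian_mx (derivative_group G) /\ invariant_by G (fmap_log F)).
Proof.
apply: regular_dicritic_abelian_iff; exact: Num.Theory.pchar_num.
Qed.
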